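(* Let $G$ be a finite simple graph that is $(P_2\cup P_4,\ \text{diamond})$-free, and let $\chi(G)$ and $\omega(G)$ denote its chromatic number and clique number. Then $\chi(G)\le 4$ if $\omega(G)=2$; $\chi(G)\le 6$ if $\omega(G)=3$; and $\chi(G)=\omega(G)$ if $\omega(G)\ge 4$. Furthermore, each of these bounds is tight: there exists a $(P_2\cup P_4,\ \text{diamond})$-free graph with $\omega=2$ and $\chi=4$, and there exists a $(P_2\cup P_4,\ \text{diamond})$-free graph with $\omega=3$ and $\chi=6$.
   Context: $P_n$ denotes the path on $n$ vertices; $P_2\cup P_4$ is the disjoint union of a $P_2$ and a $P_4$ (no edges between them). The diamond is the graph obtained from $K_4$ by deleting one edge (equivalently, a $P_3$ plus a vertex adjacent to all three vertices of the $P_3$). A graph is $\mathcal{H}$-free if it contains no induced subgraph isomorphic to any member of $\mathcal{H}$. *)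

(* Defs.v *)
From Stdlib Require List.
From mathcomp Require Import all_boot.

Set Implicit Arguments.
Unset Strict Implicit.
Unset Printing Implicit Defensive.

Record sgraph := SGraph {
  vertex :> finType;
  adj : rel vertex;
  adj_sym : symmetric adj;
  adj_irrefl : irreflexive adj }.

Definition path_rel (n : nat) : rel 'I_n :=
  fun i j => (i.+1 == j :> nat) || (j.+1 == i :> nat).

Lemma path_rel_sym n : symmetric (@path_rel n).
Proof. by move=> i j; rewrite /path_rel orbC. Qed.

Lemma path_rel_irrefl n : irreflexive (@path_rel n).
Proof. by move=> i; rewrite /path_rel orbb gtn_eqF. Qed.

Definition path_graph (n : nat) : sgraph :=
  SGraph (@path_rel_sym n) (@path_rel_irrefl n).

Definition complete_rel (n : nat) : rel 'I_n := fun i j => i != j.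

Lemma complete_rel_sym n : symmetric (@complete_rel n).
Proof. by move=> i j; rewrite /complete_rel eq_sym. Qed.

Lemma complete_rel_irrefl n : irreflexive (@complete_rel n).
Proof. by move=> i; rewrite /complete_rel eqxx. Qed.

Definition complete_graph (n : nat) : sgraph :=
  SGraph (@complete_rel_sym n) (@complete_rel_irrefl n).

Definition union_rel (G H : sgraph) : rel (G + H)%type := fun x y =>
  match x, y with
  | inl a, inl b => adj a b
  | inr a, inr b => adj a b
  | _, _ => false
  end.

Lemma union_rel_sym G H : symmetric (@union_rel G H).
Proof. by case=> a [] b //=; rewrite adj_sym. Qed.

Lemma union_rel_irrefl G H : irreflexive (@union_rel G H).
Proof. by case=> a /=; rewrite adj_irrefl. Qed.

Definition disjoint_union (G H : sgraph) : sgraph :=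
  SGraph (@union_rel_sym G H) (@union_rel_irrefl G H).

Definition del_edge_rel (G : sgraph) (u v : G) : rel G :=
  fun x y => adj x y && ([set x; y] != [set u; v]).

Lemma del_edge_rel_sym (G : sgraph) (u v : G) : symmetric (del_edge_rel u v).
Proof. by move=> x y; rewrite /del_edge_rel adj_sym setUC. Qed.

Lemma del_edge_rel_irrefl (G : sgraph) (u v : G) :
  irreflexive (del_edge_rel u v).
Proof. by move=> x; rewrite /del_edge_rel adj_irrefl. Qed.

Definition del_edge (G : sgraph) (u v : G) : sgraph :=
  SGraph (del_edge_rel_sym u v) (del_edge_rel_irrefl u v).

Definition diamond : sgraph :=
  @del_edge (complete_graph 4) (ord0 : 'I_4) (ord_max : 'I_4).

Definition P2_union_P4 : sgraph :=
  disjoint_union (path_graph 2) (path_graph 4).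

Definition induced_rel (G : sgraph) (S : {set G}) : rel {x : G | x \in S} :=
  fun x y => adj (val x) (val y).

Lemma induced_rel_sym (G : sgraph) (S : {set G}) : symmetric (@induced_rel G S).
Proof. by move=> x y; rewrite /induced_rel adj_sym. Qed.

Lemma induced_rel_irrefl (G : sgraph) (S : {set G}) :
  irreflexive (@induced_rel G S).
Proof. by move=> x; rewrite /induced_rel adj_irrefl. Qed.

Definition induced (G : sgraph) (S : {set G}) : sgraph :=
  SGraph (@induced_rel_sym G S) (@induced_rel_irrefl G S).

Definition isomorphic (G H : sgraph) : Prop :=
  exists2 f : G -> H, bijective f & forall x y : G, adj (f x) (f y) = adj x y.

Definition free (Hs : seq sgraph) (G : sgraph) : Prop :=
  forall H : sgraph, List.In H Hs ->
  ~ exists S : {set G}, isomorphic (induced S) H.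

Definition clique (G : sgraph) (S : {set G}) : bool :=
  [forall x in S, forall y in S, (x != y) ==> adj x y].

Definition clique_number (G : sgraph) : nat :=
  \max_(S : {set G} | clique S) #|S|.

Definition colorable (G : sgraph) (k : nat) : bool :=
  [exists c : {ffun G -> 'I_k}, forall x, forall y, adj x y ==> (c x != c y)].

Lemma colorable_card (G : sgraph) : colorable G #|G|.
Proof.
apply/existsP; exists [ffun x => enum_rank x].
apply/forallP=> x; apply/forallP=> y; apply/implyP=> xy.
rewrite !ffunE (inj_eq enum_rank_inj); apply: contraTneq xy => ->.
by rewrite adj_irrefl.
Qed.

Definition chromatic_number (G : sgraph) : nat :=
  ex_minn (ex_intro (fun k => colorable G k) _ (colorable_card G)).

(* Main.v *)
Require Import Defs.
From mathcomp Require Import all_boot.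

Set Implicit Arguments.
Unset Strict Implicit.
Unset Printing Implicit Defensive.

(** The vertices far from an edge induce a P4-free graph, and a component of a
    P4-free diamond-free graph is complete bipartite or a windmill, i.e. a
    vertex joined to disjoint cliques. When w = 2, two neighbourhoods of an
    edge and the bipartite remainder use 4 colors.

    When w = 3 one may assume that all degrees are at least 6. If the vertices
    far from some edge span no triangle, then two bipartite neighbourhoods and
    the bipartite remainder use 6 colors. If two triangles are far from each
    other, each neighbourhood class of one of them is independent and the
    other vertices need 3 colors. Otherwise, for a triangle abc, the windmills
    found far from ab, bc and ca have the same center r, and a neighbour of r
    in one of them has all its neighbours in N[r], hence degree at most 2.

    When w = k >= 4, fix a clique q_0 ... q_(k-1) and color the other vertices
    so that no neighbour of q_i (a vertex of label i) gets the color i; one may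
    assume that all their degrees are at least k. A P4-free set can always be
    colored so. For k >= 5 any P4 carries four distinct labels; if there is
    one, every vertex is labelled and each label class is independent, so
    i |-> i + 1 is a coloring. For k = 4, the vertices with labels among i, j
    together with the unlabelled ones are P4-free; unless one of these sets is
    triangle-free, which splits the graph into two bipartite parts, a single
    unlabelled vertex is adjacent to both ends of all edges not incident to
    it.

    The bounds for w = 2 and w = 3 are attained by the Groetzsch graph and by
    the complement of the Schlaefli graph. *)

(** * Forbidden subgraphs and basic facts on colorings *)

(** A boolean formula under the quantifiers, as in [P2P4_free], so that chosen instances can be
    moved into a goal and settled by case analysis on adjacencies. *)
Definition diamond_free (G : sgraph) : Prop := forall x y u v : G,
  [&& adj x y, adj u x, adj u y, adj v x & adj v y] ==> (u == v) || adj u v.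

(** These six conditions already force the four vertices to be distinct. *)
Definition p4 (G : sgraph) (a b c d : G) : bool :=
  [&& adj a b, adj b c, adj c d, ~~ adj a c, ~~ adj a d & ~~ adj b d].

Definition P2P4_free (G : sgraph) : Prop := forall u v a b c d : G,
  adj u v && p4 a b c d ==>
  [|| adj u a, adj u b, adj u c, adj u d, adj v a, adj v b, adj v c | adj v d].

Lemma isomorphic_inducedP (G H : sgraph) :
  (exists S : {set G}, isomorphic (induced S) H) <->
  (exists2 f : H -> G, injective f & forall x y, adj (f x) (f y) = adj x y).
Proof.
split=> [[S [g [h gK hK] gE]] | [f f_inj fE]].
  exists (fun x => val (h x)) => [x y /val_inj/(can_inj hK) // | x y].
  by rewrite -[in RHS](hK x) -[in RHS](hK y) gE.
pose S := [set f x | x : H].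
have fS x : f x \in S by apply: imset_f.
pose h x : induced S := Sub (f x) (fS x).
have h_inj : injective h by move=> x y /(congr1 val)/f_inj.
have hE x y : adj (h x) (h y) = adj x y by rewrite -fE.
have [|g hK gK] := inj_card_bij h_inj; last first.
  by exists S, g; [exists h | move=> x y; rewrite -hE !gK].
rewrite card_sig (eq_card (B := mem S)) //.
by rewrite card_imset.
Qed.

Lemma embeds_P2_union_P4 (G : sgraph) :
  (exists2 f : P2_union_P4 -> G, injective f &
     forall x y, adj (f x) (f y) = adj x y) <->
  exists u v a b c d : G, [/\ adj u v, p4 a b c d &
    ~~ [|| adj u a, adj u b, adj u c, adj u d, adj v a, adj v b, adj v c
         | adj v d]].
Proof.
split=> [[f _ fE] | [u [v [a [b [c [d]]]]]] [uv /and5P[ab bc cd ac /andP[ad bd]]]].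
  exists (f (inl (inord 0))), (f (inl (inord 1))), (f (inr (inord 0))),
    (f (inr (inord 1))), (f (inr (inord 2))), (f (inr (inord 3))).
  by rewrite /p4 !fE /= /path_rel !inordK.
rewrite !negb_or => /and5P[ua ub uc ud /and4P[va vb vc vd]].
pose f (x : P2_union_P4) : G := match x with
  | inl i => nth u [:: u; v] i | inr i => nth a [:: a; b; c; d] i end.
have fE x y : adj (f x) (f y) = adj x y.
  case: x y => [[[|[|[]]] //= ?]|[[|[|[|[|[]]]]] //= ?]];
  case=> [[[|[|[]]] //= ?]|[[|[|[|[|[]]]]] //= ?]];
  rewrite /f /= /path_rel /= ?adj_irrefl //;
  by [apply/negbTE | apply/idP; rewrite adj_sym | apply/negbTE; rewrite adj_sym].
exists f => // x y fxy.
(* No two vertices of [P2_union_P4] have the same neighbourhood, so a map that preserves adjacency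
   is injective. *)
have: forall z, adj x z = adj y z by move=> z; rewrite -!fE fxy.
case: x y {fxy} => [[[|[|[]]] //= ?]|[[|[|[|[|[]]]]] //= ?]];
case=> [[[|[|[]]] //= ?]|[[|[|[|[|[]]]]] //= ?]] => H;
  try (by congr inl; apply: val_inj); try (by congr inr; apply: val_inj);
  by [have := H (inl (inord 0)); rewrite /= /path_rel /= ?inordK
     |have := H (inl (inord 1)); rewrite /= /path_rel /= ?inordK
     |have := H (inr (inord 0)); rewrite /= /path_rel /= ?inordK
     |have := H (inr (inord 1)); rewrite /= /path_rel /= ?inordK
     |have := H (inr (inord 2)); rewrite /= /path_rel /= ?inordK
     |have := H (inr (inord 3)); rewrite /= /path_rel /= ?inordK].
Qed.

Lemma embeds_diamond (G : sgraph) :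
  (exists2 f : diamond -> G, injective f &
     forall x y, adj (f x) (f y) = adj x y) <->
  exists x y u v : G, [/\ adj x y, [&& adj u x, adj u y, adj v x & adj v y],
    u != v & ~~ adj u v].
Proof.
have E (i j : diamond) :
    adj i j = (i != j) && ~~ (((i : nat) \in [:: 0; 3]) && ((j : nat) \in [:: 0; 3])).
  rewrite /= /del_edge_rel /= /complete_rel; case: eqVneq => //= ij.
  congr negb; apply/eqP/idP => [/setP s | ].
    have := s i; have := s j; rewrite !inE !eqxx ?orbT /=.
    by case/esym/orP=> /eqP-> /esym/orP[]/eqP->.
  case: i j ij => [[|[|[|[|[]]]]] //= ?] [[|[|[|[|[]]]]] //= ?] // _ _.
    by congr setU; apply: congr1; apply: val_inj.
  by rewrite setUC; congr setU; apply: congr1; apply: val_inj.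
split=> [[f f_inj fE] | [x [y [u [v [xy /and4P[ux uy vx vy] uv nuv]]]]]].
  exists (f (inord 1 : 'I_4)), (f (inord 2 : 'I_4)), (f (inord 0 : 'I_4)),
    (f (inord 3 : 'I_4)).
  by rewrite (inj_eq f_inj) !fE !E -!(inj_eq val_inj) /= !inordK.
pose f (i : diamond) : G := nth u [:: u; x; y; v] (i : 'I_4).
have fE i j : adj (f i) (f j) = adj i j.
  rewrite E -(inj_eq val_inj).
  case: i j => [[|[|[|[|[]]]]] //= ?] [[|[|[|[|[]]]]] //= ?];
  rewrite /f /= ?adj_irrefl ?ux ?uy ?vx ?vy ?xy //;
  by [apply/negbTE | rewrite adj_sym | apply/negbTE; rewrite adj_sym].
(* Adjacency does not separate the nonadjacent twins 0 and 3 of the diamond; there injectivity comes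
   from [u != v]. *)
exists f => // i j fij; apply/eqP; apply: contraT => ij.
have := fE i j; rewrite fij adj_irrefl E ij /=.
move: fij ij uv; rewrite -(inj_eq val_inj) /f.
case: i j => [[|[|[|[|[]]]]] //= ?] [[|[|[|[|[]]]]] //= ?] //= -> //; rewrite ?eqxx //.
Qed.

Lemma freeP (G : sgraph) :
  free [:: P2_union_P4; diamond] G <-> P2P4_free G /\ diamond_free G.
Proof.
split=> [fG | [pG dG] F].
  split=> [u v a b c d | x y u v]; apply: contraT; rewrite negb_imply.
    case/andP=> /andP[uv abcd] H; case: (fG P2_union_P4); first by left.
    by apply/isomorphic_inducedP/embeds_P2_union_P4; exists u, v, a, b, c, d.
  case/andP=> /andP[xy H]; rewrite negb_or => /andP[uv nuv].
  case: (fG diamond); first by right; left.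
  by apply/isomorphic_inducedP/embeds_diamond; exists x, y, u, v.
case=> [<-|[<-|//]] /isomorphic_inducedP.
  case/embeds_P2_union_P4=> u [v [a [b [c [d [uv abcd /negP]]]]]]; apply.
  by have := pG u v a b c d; rewrite uv abcd.
case/embeds_diamond=> x [y [u [v [xy H uv]]]] /negP[].
by have := dG x y u v; rewrite xy H (negbTE uv).
Qed.

Lemma colorableP (G : sgraph) (k : nat) :
  reflect (exists c : G -> 'I_k, forall x y, adj x y -> c x != c y)
          (colorable G k).
Proof.
apply: (iffP existsP) => [[c /forallP cP] | [c cP]].
  by exists c => x y xy; have /forallP/(_ y)/implyP := cP x; apply.
exists (finfun c); apply/forallP=> x; apply/forallP=> y; apply/implyP=> xy.
by rewrite !ffunE cP.
Qed.

Lemma colorable_bounded (G : sgraph) (k : nat) (c : G -> nat) :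
  (forall x, c x < k) -> (forall x y, adj x y -> c x != c y) -> colorable G k.
Proof.
move=> ck cP; apply/colorableP; exists (fun x => Ordinal (ck x)) => x y xy.
by rewrite -(inj_eq val_inj) cP.
Qed.

Lemma chromatic_number_le (G : sgraph) (k : nat) :
  colorable G k -> chromatic_number G <= k.
Proof. by rewrite /chromatic_number; case: ex_minnP => m _; apply. Qed.

Lemma leq_chromatic_number (G : sgraph) (k : nat) :
  ~~ colorable G k -> k < chromatic_number G.
Proof.
rewrite /chromatic_number; case: ex_minnP => m /colorableP[c cP] _.
rewrite ltnNge; apply: contra => mk; apply/colorableP.
exists (fun x => widen_ord mk (c x)) => x y /cP.
by rewrite -!(inj_eq val_inj).
Qed.

Lemma clique_number_ge (G : sgraph) (S : {set G}) :
  clique S -> #|S| <= clique_number G.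
Proof. by move=> Scl; apply: (@leq_bigmax_cond _ (@clique G) (fun S => #|pred_of_set S|)). Qed.

Lemma cliqueP (G : sgraph) (S : {set G}) :
  reflect {in S &, forall x y, x != y -> adj x y} (clique S).
Proof.
apply: (iffP forall_inP) => [H x y xS yS xy | H x xS].
  by have /forall_inP/(_ y yS)/implyP := H x xS; apply.
by apply/forall_inP=> y yS; apply/implyP; apply: H.
Qed.

Lemma max_clique_ex (G : sgraph) :
  exists2 S : {set G}, clique S & #|S| = clique_number G.
Proof.
have cl0 : clique (set0 : {set G}) by apply/cliqueP=> x y; rewrite inE.
rewrite /clique_number (bigmax_eq_arg set0) //.
by case: arg_maxnP => // S Scl _; exists S.
Qed.

Lemma clique_number_le_chromatic (G : sgraph) :
  clique_number G <= chromatic_number G.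
Proof.
have [S /cliqueP Scl <-] := max_clique_ex G.
rewrite /chromatic_number; case: ex_minnP => m /colorableP[c cP] _.
have c_inj : {in S &, injective c}.
  move=> x y xS yS cxy; apply/eqP; apply: contraT => /(Scl _ _ xS yS)/cP.
  by rewrite cxy eqxx.
by rewrite -(card_in_imset c_inj) -[m in _ <= m]card_ord max_card.
Qed.

(** * Graphs given by a table *)

Section Refutation.

Variables (t : rel nat) (k : nat).

Fixpoint extract_max (A : Type) (f : A -> nat) (x : A) (s : seq A) : A * seq A :=
  if s is y :: s' then
    let: (z, r) := extract_max f y s' in
    if f z <= f x then (x, z :: r) else (z, x :: r)
  else (x, [::]).

Lemma perm_extract_max (A : eqType) (f : A -> nat) x s :
  perm_eq ((extract_max f x s).1 :: (extract_max f x s).2) (x :: s).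
Proof.
elim: s x => //= y s IHs x; have := IHs y; case: extract_max => z r /= zr.
case: ifP => _ /=; first by rewrite perm_cons.
by rewrite -[z :: x :: r]/([:: z] ++ x :: r) perm_catC /= perm_cons perm_catC.
Qed.

Definition mark (v i : nat) (s : seq (nat * seq bool)) : seq (nat * seq bool) :=
  [seq (p.1, if t v p.1 then set_nth false p.2 i true else p.2) | p <- s].

(* Exhaustive search for a k-coloring. The m colors in use are numbered by
   order of appearance, which removes the symmetry between colors; an entry
   (v, b) is an uncolored vertex with the set b of colors it cannot take, and
   the search branches on a most constrained vertex. *)
Fixpoint refute (fuel m : nat) (s : seq (nat * seq bool)) : bool :=
  if fuel is fuel'.+1 then
    if s is p :: s' then
      let: ((v, b), r) := extract_max (fun q => count id q.2) p s' in
      all (fun i => if nth false b i then true else refute fuel' m (mark v i r))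
          (iota 0 m) &&
      (if m == k then true else refute fuel' m.+1 (mark v m r))
    else false
  else false.

(** A given coloring [c] can be followed down the search tree: [cs] lists the colors of [c] in the
    order in which the branch met them, and a vertex is only marked with colors that [c] avoids
    there. This branch never closes; running out of fuel also gives [false]. *)
Lemma refuteP (n fuel m : nat) (s : seq (nat * seq bool)) (c : nat -> nat)
    (cs : seq nat) :
  (forall x, x < n -> c x < k) ->
  (forall x y, x < n -> y < n -> t x y -> c x != c y) ->
  uniq cs -> size cs = m -> all (fun i => i < k) cs ->
  {in s, forall p, p.1 < n} ->
  {in s, forall p i, nth false p.2 i -> (i < m) && (c p.1 != nth 0 cs i)} ->
  refute fuel m s = false.
Proof.
move=> ck cP; elim: fuel m s cs => // fuel IHf m [|p s] cs //= Ucs szcs csk sn sc.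
have := perm_extract_max (fun q => count id q.2) p s.
case: extract_max => -[v b] r /= /perm_mem sE.
have vbs : (v, b) \in p :: s by rewrite -sE mem_head.
have rs q : q \in r -> q \in p :: s by move=> qr; rewrite -sE inE qr orbT.
have vn : v < n := sn _ vbs.
have mark_n i : {in mark v i r, forall q, q.1 < n}.
  by move=> _ /mapP[q /rs/sn qn ->].
(* If the color of [v] is already in use, its index in [cs] is the branch to follow. *)
have [cv | cv] := boolP (c v \in cs).
  apply/negbTE; rewrite negb_and; apply/orP; left; apply/allPn.
  have im : index (c v) cs < m by rewrite -szcs index_mem.
  exists (index (c v) cs); first by rewrite mem_iota.
  have cvE := nth_index 0 cv.
  case: ifP => [bv | _]; first by have := sc _ vbs _ bv; rewrite cvE eqxx andbF.
  rewrite (IHf _ _ cs) // => _ /mapP[q /[dup] /rs qs qr ->] i /=.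
  case vq: (t v q.1); last exact: sc.
  rewrite nth_set_nth /=; case: eqP => [-> _ | _]; last exact: sc.
  by rewrite im cvE eq_sym cP // sn.
(* With all [k] colors in use, the color of [v] would be one too many. *)
case: eqP => [mk | _].
  have: size (c v :: cs) <= size (iota 0 k).
    apply: uniq_leq_size => [|i]; first by rewrite /= cv.
    by rewrite mem_iota inE => /predU1P[-> | /(allP csk) //]; apply: ck.
  by rewrite /= szcs mk size_iota ltnn.
rewrite (IHf _ _ (rcons cs (c v))) ?andbF ?rcons_uniq ?cv ?size_rcons ?szcs //.
  by rewrite all_rcons csk andbT; apply: ck.
move=> _ /mapP[q /[dup] /rs qs qr ->] i /=.
have bq : nth false q.2 i ->
    (i < m.+1) && (c q.1 != nth 0 (rcons cs (c v)) i).
  by case/(sc _ qs)/andP=> im; rewrite nth_rcons szcs im ltnW.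
case vq: (t v q.1) => //; rewrite nth_set_nth /=; case: eqP => [-> _ | _ //].
by rewrite ltnSn nth_rcons szcs ltnn eqxx eq_sym cP // sn.
Qed.

End Refutation.

Section TableGraph.

Variables (n : nat) (t : rel nat).

Definition nbrs (x : nat) : seq nat := [seq y <- iota 0 n | t x y].

Hypotheses (t_sym : all (fun x => all (fun y => t x y == t y x) (iota 0 n)) (iota 0 n))
           (t_irr : all (fun x => ~~ t x x) (iota 0 n)).

Lemma table_sym : symmetric (fun i j : 'I_n => t i j).
Proof.
move=> i j; apply/eqP.
by apply: (allP (allP t_sym i _)); rewrite mem_iota /=.
Qed.

Lemma table_irrefl : irreflexive (fun i j : 'I_n => t i j).
Proof. by move=> i; apply/negbTE/(allP t_irr); rewrite mem_iota /=. Qed.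

Definition table_graph : sgraph := SGraph table_sym table_irrefl.

Lemma table_graph_colorable (k : nat) (s : seq nat) :
  all (fun x => nth 0 s x < k) (iota 0 n) ->
  all (fun x => all (fun y => nth 0 s x != nth 0 s y) (nbrs x)) (iota 0 n) ->
  colorable table_graph k.
Proof.
have io (i : 'I_n) : val i \in iota 0 n by rewrite mem_iota /=.
move=> /allP sk /allP sP; apply: (@colorable_bounded table_graph _ (fun i : 'I_n => nth 0 s i)).
  by move=> i; apply: (sk i (io i)).
by move=> i j ij; apply: (allP (sP i (io i))); by rewrite mem_filter io andbT.
Qed.

Lemma table_graph_not_colorable (k fuel : nat) :
  refute t k fuel 0 [seq (x, [::]) | x <- iota 0 n] ->
  ~~ colorable table_graph k.
Proof.
apply: contraL => /colorableP[c cP]; apply/negbT.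
pose c' x := if @insub _ _ 'I_n x is Some i then c i : nat else 0.
apply: (@refuteP t k n fuel 0 _ c' [::]) => // [x xn|x y xn yn xy||].
- by rewrite /c'; case: insubP => [i _ _|]; rewrite ?xn // ltn_ord.
- rewrite /c'; case: insubP => [i _ iE|]; rewrite ?xn //.
  case: insubP => [j _ jE|]; rewrite ?yn //.
  by apply: cP; rewrite /= -iE -jE in xy.
- by move=> _ /mapP[x xn ->]; rewrite mem_iota in xn.
by move=> _ /mapP[x _ ->] i /=; rewrite nth_nil.
Qed.

Lemma table_graph_codegP (m : nat) :
  all (fun x => all (fun y => size [seq z <- nbrs x | t y z] <= m) (nbrs x))
      (iota 0 n) ->
  forall i j : table_graph, adj i j -> #|[set z | adj i z & adj j z]| <= m.
Proof.
have io (i : 'I_n) : val i \in iota 0 n by rewrite mem_iota /=.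
move=> /allP H i j ij; have jn : val j \in nbrs i by by rewrite mem_filter io andbT.
apply: leq_trans (allP (H i (io i)) _ jn).
rewrite -filter_predI size_filter cardsE cardE size_filter.
rewrite -val_enum_ord count_map enumT; apply: eq_leq; apply: eq_count => z /=.
exact: andbC.
Qed.

(** The test asks for more: the vertices far from an edge must induce a matching, so that they
    contain not even a P3. *)
Lemma table_graph_P2P4_free :
  all (fun x => all (fun y =>
      let s := [seq z <- iota 0 n | ~~ (t x z || t y z)] in
      all (fun z => size [seq w <- s | t z w] <= 1) s) (nbrs x)) (iota 0 n) ->
  P2P4_free table_graph.
Proof.
have io (i : 'I_n) : val i \in iota 0 n by rewrite mem_iota /=.
move=> /allP H u v a b c d; apply/implyP=> /andP[uv /and5P[ab bc cd _ /andP[ad _]]].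
have vn : val v \in nbrs u by by rewrite mem_filter io andbT.
have /= /allP{H} H := allP (H u (io u)) _ vn.
apply: contraT; rewrite !negb_or => /and5P[ua ub uc _ /and4P[va vb vc _]].
have := H b; rewrite mem_filter io andbT negb_or ub vb /= => /(_ isT).
set s := filter _ _ => s1.
have: size [:: val a; val c] <= size s.
  apply: uniq_leq_size => /= [|x].
    rewrite inE andbT (inj_eq val_inj); apply: contraNneq ad => ->.
    exact: cd.
  rewrite !inE => /pred2P[]->; rewrite !mem_filter io ?negb_or.
    by rewrite ua va !andbT; have := ab; rewrite adj_sym.
  by rewrite uc vc !andbT; apply: bc.
by move/(leq_trans)/(_ s1).
Qed.

End TableGraph.

(** * The extremal graphs *)

Lemma codeg_diamond_free (G : sgraph) :
  (forall x y : G, adj x y -> #|[set z | adj x z & adj y z]| <= 1) ->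
  diamond_free G.
Proof.
move=> H x y u v; apply/implyP=> /and5P[/H/card_le1_eqP xy ux uy vx vy].
by rewrite (xy u v) ?eqxx // inE !(adj_sym _ u, adj_sym _ v) ?ux ?uy ?vx ?vy.
Qed.

(** Two vertices of a clique have all its other vertices as common neighbours. *)
Lemma codeg_clique_number (G : sgraph) (m : nat) :
  (forall x y : G, adj x y -> #|[set z | adj x z & adj y z]| <= m) ->
  clique_number G <= m.+2.
Proof.
move=> H; apply/bigmax_leqP=> S /cliqueP Scl.
have [->|[x xS]] := set_0Vmem S; first by rewrite cards0.
rewrite (cardsD1 x) xS ltnS.
have [->|[y]] := set_0Vmem (S :\ x); first by rewrite cards0.
rewrite 2!inE => /andP[yx yS]; rewrite (cardsD1 y) !inE yx yS ltnS.
apply: leq_trans (H x y _); last by rewrite Scl // eq_sym.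
apply/subset_leq_card/subsetP=> z; rewrite !inE => /and3P[zy zx zS].
by rewrite !Scl // eq_sym.
Qed.

(* The Groetzsch graph: a 5-cycle 0..4, the copy 5 + i of the vertex i, joined
   to the neighbours of i, and a vertex 10 joined to all the copies. *)
Definition groetzsch_rel : rel nat := fun x y =>
  let c5 i j := (i == j.+1 %[mod 5]) || (j == i.+1 %[mod 5]) in
  [|| (x < 5) && (y < 5) && c5 x y,
      (x < 5 <= y) && (y < 10) && c5 x y,
      (y < 5 <= x) && (x < 10) && c5 x y,
      (x == 10) && (5 <= y < 10) | (y == 10) && (5 <= x < 10)].

(* The collinearity graph of the generalized quadrangle GQ(2,4), i.e. the
   intersection graph of the 27 lines of the Fermat cubic surface. With w a
   primitive cube root of 1, the vertex 9 k + 3 a + b stands for the line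
   X_0 + w^a X_i = X_j + w^b X_l = 0, where (i,j,l) is (1,2,3), (2,1,3), (3,1,2)
   for k = 0, 1, 2. *)
Definition lines_rel : rel nat := fun x y =>
  let k x := x %/ 9 in let a x := x %/ 3 %% 3 in let b x := x %% 3 in
  let meet x y :=
    match k x, k y with
    | 0, 1 => a y + b x == a x + b y %[mod 3]
    | 0, 2 => a y == a x + b x + b y %[mod 3]
    | 1, 2 => a y + b y == a x + b x %[mod 3]
    | _, _ => false
    end in
  if k x == k y then (a x == a y) (+) (b x == b y) else meet x y || meet y x.

Definition table (n : nat) (t : rel nat) : seq (seq bool) :=
  mkseq (fun x => mkseq (t x) n) n.

Definition table_rel (s : seq (seq bool)) : rel nat :=
  fun x y => nth false (nth [::] s x) y.

(** Evaluated once, so that the checks read an entry of the adjacency matrix instead of repeating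
    modular arithmetic. *)
Definition groetzsch_table := Eval vm_compute in table 11 groetzsch_rel.
Definition lines_table := Eval vm_compute in table 27 lines_rel.

Definition groetzsch : sgraph :=
  @table_graph 11 (table_rel groetzsch_table) isT isT.

Definition lines_graph : sgraph :=
  @table_graph 27 (table_rel lines_table) isT isT.

Lemma groetzsch_codeg (x y : groetzsch) :
  adj x y -> #|[set z | adj x z & adj y z]| <= 0.
Proof. by apply: table_graph_codegP; vm_compute. Qed.

Lemma groetzsch_free : free [:: P2_union_P4; diamond] groetzsch.
Proof.
apply/freeP; split; first by apply: table_graph_P2P4_free; vm_compute.
by apply: codeg_diamond_free => x y /groetzsch_codeg/leq_trans->.
Qed.

Lemma lines_codeg (x y : lines_graph) :
  adj x y -> #|[set z | adj x z & adj y z]| <= 1.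
Proof. by apply: table_graph_codegP; vm_compute. Qed.

Lemma lines_free : free [:: P2_union_P4; diamond] lines_graph.
Proof.
apply/freeP; split; first by apply: table_graph_P2P4_free; vm_compute.
exact: codeg_diamond_free lines_codeg.
Qed.

Lemma groetzsch_clique_number : clique_number groetzsch = 2.
Proof.
apply/eqP; rewrite eqn_leq codeg_clique_number; last exact: groetzsch_codeg.
pose x : groetzsch := (inord 0 : 'I_11); pose y : groetzsch := (inord 1 : 'I_11).
have xy : adj x y by rewrite /= !inordK.
have nxy : x != y by apply: contraTneq xy => ->; rewrite adj_irrefl.
have <- : #|[set x; y]| = 2 by rewrite cards2 nxy.
apply/clique_number_ge/cliqueP=> u v.
by rewrite !inE => /pred2P[]-> /pred2P[]->; rewrite ?eqxx // adj_sym.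
Qed.

Lemma lines_clique_number : clique_number lines_graph = 3.
Proof.
apply/eqP; rewrite eqn_leq codeg_clique_number; last exact: lines_codeg.
pose x : lines_graph := (inord 0 : 'I_27).
pose y : lines_graph := (inord 1 : 'I_27).
pose z : lines_graph := (inord 2 : 'I_27).
have xy : adj x y by rewrite /= !inordK.
have xz : adj x z by rewrite /= !inordK.
have yz : adj y z by rewrite /= !inordK.
have adj_neq (u v : lines_graph) : adj u v -> u != v.
  by move=> uv; apply: contraTneq uv => ->; rewrite adj_irrefl.
have <- : #|x |: [set y; z]| = 3.
  by rewrite cardsU1 cards2 !inE negb_or !adj_neq.
apply/clique_number_ge/cliqueP=> u v.
rewrite !inE => /or3P[]/eqP-> /or3P[]/eqP->; rewrite ?eqxx // => _;
  by rewrite // adj_sym.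
Qed.

Lemma groetzsch_chromatic_number : chromatic_number groetzsch = 4.
Proof.
apply/eqP; rewrite eqn_leq leq_chromatic_number ?andbT.
  apply/chromatic_number_le.
  (* The 5-cycle gets 0, 1, 0, 1, 2, each copy the color of its original, and the last vertex a
     fourth color. *)
  by apply: (@table_graph_colorable 11 _ _ _ 4 [:: 0; 1; 0; 1; 2; 0; 1; 0; 1; 2; 3]).
(* The fuel exceeds the number of vertices, hence the depth of the search. *)
by apply: (@table_graph_not_colorable 11 _ _ _ 3 12); vm_compute.
Qed.

Lemma lines_chromatic_number : chromatic_number lines_graph = 6.
Proof.
apply/eqP; rewrite eqn_leq leq_chromatic_number ?andbT.
  apply/chromatic_number_le.
  by apply: (@table_graph_colorable 27 _ _ _ 6
    [:: 0; 1; 2; 1; 2; 0; 2; 0; 3; 1; 3; 4; 4; 1; 3; 3; 4; 1; 2; 0; 5; 5; 2; 0;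
        0; 5; 2]).
by apply: (@table_graph_not_colorable 27 _ _ _ 5 28); vm_compute.
Qed.

(** * P4-free diamond-free sets *)

Definition P4_free (G : sgraph) (X : {set G}) : Prop :=
  forall a b c d, a \in X -> b \in X -> c \in X -> d \in X -> ~~ p4 a b c d.

Definition triangle (G : sgraph) (x y z : G) : bool :=
  [&& adj x y, adj y z & adj x z].

Definition triangle_free (G : sgraph) (X : {set G}) : Prop :=
  forall x y z, x \in X -> y \in X -> z \in X -> ~~ triangle x y z.

Definition cadj (G : sgraph) (x y : G) : bool := (x == y) || adj x y.

Ltac adj_hyps := repeat match goal with
  | H : is_true (adj ?x ?y) |- context [adj ?x ?y] => rewrite H
  | H : is_true (adj ?x ?y) |- context [adj ?y ?x] => rewrite (adj_sym y x) H
  | H : is_true (~~ adj ?x ?y) |- context [adj ?x ?y] => rewrite (negbTE H)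
  | H : is_true (~~ adj ?x ?y) |- context [adj ?y ?x] =>
      rewrite (adj_sym y x) (negbTE H)
  | H : is_true (?x != ?y) |- context [?x == ?y] => rewrite (negbTE H)
  | H : is_true (?x != ?y) |- context [?y == ?x] =>
      rewrite (eq_sym y x) (negbTE H)
  end.

Ltac adj_norm := rewrite ?adj_irrefl ?eqxx; repeat
  match goal with |- context [adj ?x ?y] =>
    match goal with |- context [adj y x] => rewrite (adj_sym y x) end end;
  repeat
  match goal with |- context [?x == ?y] =>
    match goal with |- context [y == x] => rewrite (eq_sym y x) end end.

(** Decides a goal into which instances of the hypotheses have been moved: known adjacencies are
    rewritten, [adj] and [==] are oriented, and the remaining atoms are split as independent
    booleans. *)
Ltac adj_split := rewrite /cadj /triangle /p4 /=; adj_hyps; adj_norm; rewrite /=;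
  repeat (match goal with
          | |- context [adj ?x ?y] => case: (adj x y)
          | |- context [?x == ?y] => case: (x == y) end => //=); try by [].

Section Basics.

Variable G : sgraph.
Implicit Types (x y z u v : G) (X Y : {set G}).

Lemma adj_neq x y : adj x y -> x != y.
Proof. by apply: contraTneq => ->; rewrite adj_irrefl. Qed.

Lemma cadj_sym x y : cadj x y = cadj y x.
Proof. by rewrite /cadj eq_sym adj_sym. Qed.

Lemma P4_free_sub X Y : Y \subset X -> P4_free X -> P4_free Y.
Proof. by move=> /subsetP YX pX a b c d /YX aX /YX bX /YX cX /YX dX; apply: pX. Qed.

Lemma triangle_free_sub X Y : Y \subset X -> triangle_free X -> triangle_free Y.
Proof. by move=> /subsetP YX tX x y z /YX xX /YX yX /YX zX; apply: tX. Qed.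

(** An edge [ab] dominates its component, since a further vertex would end a P4. The neighbourhoods
    of [a] and [b] are independent, so they are the color classes of this component, which is [C]
    below; the rest is done by induction. *)
Lemma P4_triangle_free_bipartite X : P4_free X -> triangle_free X ->
  exists c : G -> bool, {in X &, forall x y, adj x y -> c x != c y}.
Proof.
have [n] := ubnP #|X|; elim: n X => // n IHn X; rewrite ltnS => Xn pX tX.
have [/existsP[a /and3P[aX /existsP[b /andP[bX ab]] _]]|noE] :=
    boolP [exists a, [&& a \in X, [exists b, (b \in X) && adj a b] & true]]; last first.
  exists xpredT => x y xX yX xy; case/negP: noE.
  by apply/existsP; exists x; rewrite xX andbT; apply/existsP; exists y; rewrite yX.
pose C := [set x in X | adj a x || adj b x].
have [|||c cP] := IHn (X :\: C).
- apply: leq_trans Xn; apply: proper_card; apply/properP; split.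
    exact: subsetDl.
  by exists a => //; rewrite !inE aX [adj b a]adj_sym ab orbT.
- by apply: P4_free_sub pX; apply: subsetDl.
- by apply: triangle_free_sub tX; apply: subsetDl.
exists (fun x => if x \in C then adj a x else c x) => x y xX yX xy.
have cross u v : u \in C -> v \in X -> v \notin C -> ~~ adj u v.
  rewrite !inE => /andP[uX H] vX; rewrite vX /=; move: H ab.
  move: (pX v u a b vX uX aX bX) (pX v u b a vX uX bX aX) (tX a b u aX bX uX).
  by adj_split.
case: ifP => xC; case: ifP => yC.
- move: xC yC; rewrite !inE => /andP[_ +] /andP[_ +].
  move: xy (tX a x y aX xX yX) (tX b x y bX xX yX) (pX x a b y xX aX bX yX).
  move: (pX y a b x yX aX bX xX) ab (tX a b x aX bX xX) (tX a b y aX bX yX).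
  by adj_split.
- by case/negP: (cross x y xC yX (negbT yC)).
- by case/negP: (cross y x yC xX (negbT xC)); rewrite adj_sym.
by apply: cP => //; rewrite inE ?xC ?yC.
Qed.

Hypothesis dG : diamond_free G.

(** Diamond-freeness makes [z] nonadjacent to [u] and [v]. Then [u x y v] is a P4 if [u] and [v] are
    nonadjacent, and [z x u v] is one if they are adjacent. *)
Lemma attach_unique X x y z u v : P4_free X ->
  [&& x \in X, y \in X, z \in X, u \in X & v \in X] -> triangle x y z ->
  u != y -> v != x -> adj u x -> ~~ adj u y -> adj v y -> ~~ adj v x -> False.
Proof.
move=> pX /and5P[xX yX zX uX vX] xyz uy vx.
move: xyz uy vx (pX u x y v uX xX yX vX) (pX z x u v zX xX uX vX).
move: (dG x z y u) (dG y z x v).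
by adj_split.
Qed.

(** By [attach_unique], the edges leaving the maximal clique [K] around the triangle all start at
    one vertex [w]. A vertex at distance 2 from [w] would then end a P4 through [w] and another
    vertex of [K]. The last clause makes the closed neighbourhood of [w] a component of [X]. *)
Lemma windmill X x y z : P4_free X ->
  [&& x \in X, y \in X & z \in X] -> triangle x y z ->
  exists w, [/\ w \in X, [&& cadj w x, cadj w y & cadj w z] &
    {in X &, forall u v, adj u v -> cadj w u -> cadj w v}].
Proof.
move=> pX /and3P[xX yX zX] xyz.
pose K := [set c in X | [&& cadj x c, cadj y c & cadj z c]].
have [xK yK zK] : [/\ x \in K, y \in K & z \in K].
  by rewrite !inE xX yX zX; split; move: xyz; adj_split.
have Kcl c d : c \in K -> d \in K -> cadj c d.
  rewrite !inE => /andP[_ /and3P[xc yc zc]] /andP[_ /and3P[xd yd zd]].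
  case/orP: (xc) => [/eqP<- //|]; case/orP: (yc) => [/eqP<- //|].
  case/orP: (xd) => [/eqP<-|]; first by rewrite cadj_sym.
  case/orP: (yd) => [/eqP<-|]; first by rewrite cadj_sym.
  by move: xyz (dG x y c d); adj_split.
have Kout u c d : u \in X -> u \notin K -> c \in K -> d \in K ->
    adj u c -> adj u d -> c = d.
  move=> uX uK cK dK uc ud; apply/eqP; apply: contraNT uK => cd.
  have cad := Kcl c d cK dK; rewrite inE uX /=.
  suff Ku w : w \in K -> cadj w u by rewrite !Ku.
  move=> wK; have := Kcl w c wK cK; have := Kcl w d wK dK.
  rewrite {1 2}/cadj => /predU1P[->|wd]; first by rewrite cadj_sym /cadj ud orbT.
  case/predU1P=> [->|wc]; first by rewrite cadj_sym /cadj uc orbT.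
  by move: cad cd uc ud wc wd (dG c d w u); adj_split.
have [w wK Kw] : exists2 w, w \in K &
    forall u c, u \in X -> u \notin K -> c \in K -> adj u c -> c = w.
  case: (pickP [pred p : G * G | [&& p.1 \in X, p.1 \notin K, p.2 \in K & adj p.1 p.2]]).
    case=> [u c] /= /and4P[uX uK cK uc]; exists c => // v d vX vK dK vd.
    apply/eqP; apply: contraT => dc.
    (* [attach_unique] needs a third vertex of [K] to complete [cd] to a triangle. *)
    have [t [tK tc td]] : exists t, [/\ t \in K, t != c & t != d].
      have [xy yz xz] := and3P xyz.
      have [xc|xc] := eqVneq x c; have [xd|xd] := eqVneq x d; try by exists x.
      + by rewrite -xc -xd eqxx in dc.
      + have [yd|yd] := eqVneq y d; last by
        exists y; split=> //; rewrite -xc eq_sym adj_neq.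
        by exists z; split=> //; rewrite -?xc -?yd eq_sym adj_neq.
      have [yc|yc] := eqVneq y c; last by
        exists y; split=> //; rewrite -xd eq_sym adj_neq.
      by exists z; split=> //; rewrite -?xd -?yc eq_sym adj_neq.
    have KX s : s \in K -> s \in X by rewrite inE => /andP[].
    have uv s r : s \in K -> r \in X -> r \notin K -> s != r by move=> sK _; apply: contraNneq => <-.
    have cad := Kcl c d cK dK; have cat := Kcl c t cK tK; have dat := Kcl d t dK tK.
    have xyz' : triangle c d t by move: cad cat dat dc tc td; adj_split.
    case: (@attach_unique X c d t u v) => //.
    - by rewrite (KX c) // (KX d) // (KX t) // uX vX.
    - by rewrite eq_sym uv.
    - by rewrite eq_sym uv.
    - by apply: contraTN (dc) => ud; rewrite (Kout u c d) ?eqxx.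
    by apply: contraTN (dc) => vc; rewrite (Kout v c d) ?eqxx.
  move=> p0; exists x => // u c uX uK cK uc; have := p0 (u, c).
  by rewrite /= uX uK cK uc.
have wX : w \in X by move: wK; rewrite inE => /andP[].
exists w; split=> //; first by rewrite !Kcl.
move=> u v uX vX uv wu; have [vK|vK] := boolP (v \in K); first exact: Kcl.
have [uK|uK] := boolP (u \in K).
  have <- : u = w by apply: (Kw v) => //; rewrite adj_sym.
  by rewrite /cadj uv orbT.
case/predU1P: wu => [wu|wu]; first by rewrite wu /cadj uv orbT.
have [t tK tw] : exists2 t, t \in K & t != w.
  have [xw|] := eqVneq x w; last by exists x.
  by exists y => //; rewrite -xw eq_sym adj_neq //; case/and3P: xyz.
have tX : t \in X by move: tK; rewrite inE => /andP[].
have tu : ~~ adj t u.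
  by apply: contraTN tw => tu; rewrite (Kw u t) ?eqxx // adj_sym.
have tv : ~~ adj t v.
  by apply: contraTN tw => tv; rewrite (Kw v t) ?eqxx // adj_sym.
have := Kcl t w tK wK; move: tw tu tv wu uv (pX v u w t vX uX wX tX).
by adj_split.
Qed.

End Basics.

(** * Clique number at most 3 *)

Definition far (G : sgraph) (a b : G) : {set G} :=
  [set x | ~~ adj a x & ~~ adj b x].

Definition nbhd (G : sgraph) (x : G) : {set G} := [set y | adj x y].

Lemma far_P4_free (G : sgraph) (a b : G) :
  P2P4_free G -> adj a b -> P4_free (far a b).
Proof.
move=> pG ab x y z t; rewrite !inE => /andP[ax bx] /andP[ay by_] /andP[az bz] /andP[at_ bt].
by apply/negP=> xyzt; have := pG a b x y z t; rewrite ab xyzt; adj_split.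
Qed.

Lemma addn_bool_neq (n : nat) (b1 b2 : bool) : b1 != b2 -> n + b1 != n + b2.
Proof. by rewrite eqn_add2l; case: b1 b2 => [] []. Qed.

Lemma triangle_free_colorable (G : sgraph) :
  P2P4_free G -> triangle_free [set: G] -> colorable G 4.
Proof.
move=> pG tG; have tf (x y z : G) : ~~ triangle x y z by apply: tG; rewrite inE.
have [/existsP[a /existsP[b ab]]|noE] := boolP [exists a : G, exists b, adj a b];
  last first.
  apply: (colorable_bounded (c := fun=> 0)) => // x y xy; case/negP: noE.
  by apply/existsP; exists x; apply/existsP; exists y.
have [|c cP] := P4_triangle_free_bipartite (far_P4_free pG ab).
  by move=> x y z _ _ _; apply: tf.
apply: (colorable_bounded
  (c := fun x => if adj a x then 0 else if adj b x then 1 else 2 + c x)).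
  by move=> x; case: ifP => // _; case: ifP => // _; case: (c x).
move=> x y xy; have := tf a x y; have := tf b x y; have := cP x y.
rewrite /triangle xy !inE.
case: (adj a x) (adj a y) (adj b x) (adj b y) => [] [] [] [] //= H _ _;
  by apply: addn_bool_neq; apply: H.
Qed.

Section CliqueNumber3.

Variable G : sgraph.
Implicit Types (a b c d e f u v w x y z r s : G).
Hypotheses (pG : P2P4_free G) (dG : diamond_free G).
Hypothesis K4f : forall x y z w,
  ~~ [&& triangle x y z, adj w x, adj w y & adj w z].

(** Even a P3 in the neighbourhood of [a] would form a diamond with [a]. *)
Lemma nbhd_P4_free a : P4_free (nbhd a).
Proof.
move=> x y z w; rewrite !inE => ax ay az aw; apply/negP=> /[dup] xyzw.
have xz : x != z.
  by apply/eqP=> xz; move: xyzw; rewrite /p4 xz; case: (adj z w); rewrite ?andbF.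
by move: ax ay az xz (dG a y x z); adj_split.
Qed.

Lemma nbhd_triangle_free a : triangle_free (nbhd a).
Proof.
by move=> x y z; rewrite !inE => ax ay az; move: ax ay az (K4f x y z a); adj_split.
Qed.

Lemma far_triangle_free_colorable a b :
  adj a b -> triangle_free (far a b) -> colorable G 6.
Proof.
move=> ab tR.
have [c1 c1P] := P4_triangle_free_bipartite (@nbhd_P4_free a) (@nbhd_triangle_free a).
have [c2 c2P] := P4_triangle_free_bipartite (@nbhd_P4_free b) (@nbhd_triangle_free b).
have [c3 c3P] := P4_triangle_free_bipartite (far_P4_free pG ab) tR.
apply: (colorable_bounded
  (c := fun x => if adj a x then c1 x : nat else if adj b x then 2 + c2 x
                 else 4 + c3 x)).
  by move=> x; case: ifP => _; [case: (c1 x) | case: ifP => _; [case: (c2 x) | case: (c3 x)]].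
move=> x y xy; have := c1P x y; have := c2P x y; have := c3P x y.
rewrite !inE xy; case: (adj a x) (adj a y) (adj b x) (adj b y) => [] [] [] [] /= H3 H2 H1.
all: by [apply: (@addn_bool_neq 0); apply: H1 | apply: addn_bool_neq; apply: H2
  | apply: addn_bool_neq; apply: H3 | case: (c1 x) | case: (c1 y) | case: (c2 x) | case: (c2 y)].
Qed.

Hypothesis deg6 : forall x, 6 <= #|nbhd x|.

(** The edge [xz] has at most one common neighbour, so [x] would have degree at most 2. *)
Lemma nbhd_not_in_cadj x z : adj x z -> (forall u, adj x u -> cadj z u) -> False.
Proof.
move=> xz H; have := deg6 x; rewrite (cardsD1 z) inE xz /= add1n ltnS.
suff: #|nbhd x :\ z| <= 1 by case: #|_| => [|[]].
apply/card_le1_eqP=> u v; rewrite !inE => /andP[uz xu] /andP[vz xv].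
move: (H u xu) (H v xv); rewrite /cadj !(eq_sym z) (negbTE uz) (negbTE vz) /=.
move=> zu zv; apply/eqP; apply: contraT => uv.
by move: xz xu xv zu zv uv (dG x z u v) (K4f x z u v); adj_split.
Qed.

Definition far3 a b c : {set G} :=
  [set x | [&& ~~ adj a x, ~~ adj b x & ~~ adj c x]].

Lemma far3_rot a b c : far3 a b c = far3 b c a.
Proof. by apply/setP=> x; rewrite !inE [in RHS]andbA andbC. Qed.

Lemma triangle_rot a b c : triangle a b c = triangle b c a.
Proof. by adj_split. Qed.

Lemma adj_triangle_unique a b c x : triangle a b c -> adj a x -> x != b ->
  x != c -> ~~ adj b x && ~~ adj c x.
Proof.
by move=> + ax xb xc; move: (dG a b c x) (dG a c b x) (K4f a b c x); adj_split.
Qed.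

(** The path [c a x y] is a P4, and the edge [uv] is far from [c] and [a]. *)
Lemma far3_edge_hit a b c x y u v : triangle a b c -> adj a x ->
  x != b -> x != c -> y \in far3 a b c -> adj x y ->
  u \in far3 a b c -> v \in far3 a b c -> adj u v ->
  [|| adj u x, adj u y, adj v x | adj v y].
Proof.
move=> abc ax xb xc; have /andP[bx cx] := adj_triangle_unique abc ax xb xc.
rewrite !inE => /and3P[ay by_ cy] xy /and3P[au bu cu] /and3P[av bv cv] uv.
by case/and3P: abc => ab bc ac; move: (pG u v c a x y); adj_split.
Qed.

Lemma far3_P4_free a b c : triangle a b c -> P4_free (far3 a b c).
Proof.
case/and3P=> ab _ _; apply: P4_free_sub (far_P4_free pG ab).
by apply/subsetP=> x; rewrite !inE => /and3P[-> ->].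
Qed.

(** * Two triangles far from each other *)

Section TwoTriangles.

Variables a b c d e f : G.
Hypotheses (abc : triangle a b c) (def : triangle d e f).
Hypothesis far_def : [&& d \in far3 a b c, e \in far3 a b c & f \in far3 a b c].

(** Neither [x] nor a vertex [y] outside [def] has two neighbours in [def], while [far3_edge_hit]
    makes [xy] touch all three edges of [def]. So each has one neighbour there, and these differ;
    the third vertex of [def], the neighbour of [y], [y] and [x] form a P4 far from [bc]. *)
Lemma far3_nbr_l x y : adj a x -> x != b -> x != c -> y \in far3 a b c ->
  adj x y -> [|| y == d, y == e | y == f].
Proof.
move=> ax xb xc yR xy; case/and3P: far_def => dR eR fR.
have /andP[bx cx] := adj_triangle_unique abc ax xb xc.
have /and3P[de ef df] := def.
have bc : adj b c by case/and3P: abc.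
have hit := far3_edge_hit abc ax xb xc yR xy.
have xn t : t \in far3 a b c -> x != t.
  by apply: contraTneq => <-; rewrite inE ax.
have farR t : t \in far3 a b c -> t \in far b c by rewrite !inE => /and3P[_ -> ->].
have xF : x \in far b c by rewrite inE bx cx.
have P := far_P4_free pG bc.
apply: contraT; rewrite !negb_or => /and3P[yd ye yf].
have P6 t t' : t \in far3 a b c -> t' \in far3 a b c -> ~~ p4 t' t y x.
  by move=> /farR tR /farR t'R; apply: P => //; apply: farR.
move: (P6 d e dR eR) (P6 d f dR fR) (P6 e d eR dR) (P6 e f eR fR) (P6 f d fR dR) (P6 f e fR eR).
have xd' := xn d dR; have xe' := xn e eR; have xf' := xn f fR.
move: (hit _ _ dR eR de) (hit _ _ eR fR ef) (hit _ _ dR fR df).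
move: (dG d e f x) (dG d f e x) (dG e f d x) (K4f d e f x).
move: (dG d e f y) (dG d f e y) (dG e f d y) (K4f d e f y).
by adj_split.
Qed.

End TwoTriangles.

Lemma far3_nbr a b c d e f x y : triangle a b c -> triangle d e f ->
  [&& d \in far3 a b c, e \in far3 a b c & f \in far3 a b c] ->
  x \notin far3 a b c -> y \in far3 a b c -> adj x y ->
  [|| y == d, y == e | y == f].
Proof.
move=> abc def defR xR yR xy.
have [xa xb xc] : [/\ x != a, x != b & x != c].
  by split; apply: contraTneq yR => <-; rewrite !inE xy ?andbF.
move: xR; rewrite inE !negb_and !negbK => /or3P[ax|bx|cx].
- exact: (far3_nbr_l abc def defR ax xb xc yR xy).
- rewrite triangle_rot far3_rot in abc defR yR.
  exact: (far3_nbr_l abc def defR bx xc xa yR xy).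
rewrite -triangle_rot -far3_rot in abc defR yR.
exact: (far3_nbr_l abc def defR cx xa xb yR xy).
Qed.

(** The windmill around [def] has its center in [def], as there is no K4. If [w] were far from
    [abc], it would be adjacent to this center, and by [far3_nbr] all its neighbours would be far
    from [abc] too, hence in the same windmill, against [nbhd_not_in_cadj]. *)
Lemma far3_sep a b c d e f w : triangle a b c -> triangle d e f ->
  [&& d \in far3 a b c, e \in far3 a b c & f \in far3 a b c] ->
  ~~ [|| w == d, w == e | w == f] ->
  [|| adj w d, adj w e | adj w f] -> w \notin far3 a b c.
Proof.
move=> abc def defR wn wdef; apply/negP=> wR.
have [z [zR zdef zP]] := windmill dG (far3_P4_free abc) defR def.
have zT : [|| z == d, z == e | z == f].
  move: zdef; rewrite /cadj; case/and3P.
  case/predU1P=> [->|zd]; first by rewrite eqxx.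
  case/predU1P=> [->|ze]; first by rewrite eqxx !orbT.
  case/predU1P=> [->|zf]; first by rewrite eqxx !orbT.
  by case/negP: (K4f d e f z); rewrite def zd ze zf.
have zw : z != w by apply: contraNneq wn => <-.
have nR u : adj w u -> u \in far3 a b c.
  move=> wu; apply: contraR wn => uR.
  by apply: far3_nbr uR wR _ => //; rewrite adj_sym.
have zNw : cadj z w.
  case/and3P: defR => dR eR fR; case/and3P: zdef => zd ze zf.
  by case/or3P: wdef => wt; [apply: zP zd | apply: zP ze | apply: zP zf];
    rewrite // adj_sym.
have wz : adj w z by move: zNw; rewrite /cadj (negbTE zw) /= adj_sym.
by apply: (nbhd_not_in_cadj wz) => u wu; apply: zP zNw => //; apply: nR.
Qed.

Lemma far3_swap a b c d e f :
  [&& d \in far3 a b c, e \in far3 a b c & f \in far3 a b c] =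
  [&& a \in far3 d e f, b \in far3 d e f & c \in far3 d e f].
Proof. by rewrite !inE; adj_split. Qed.

(** By [far3_sep] with the triangles exchanged, [x] and [y] have neighbours in [def]. If they were
    adjacent, they would have one each, and distinct ones, which gives a P4 far from [bc] that
    starts at the third vertex of [def]. *)
Lemma far_triangles_indep a b c d e f x y : triangle a b c -> triangle d e f ->
  [&& d \in far3 a b c, e \in far3 a b c & f \in far3 a b c] ->
  ~~ [|| x == a, x == b | x == c] -> ~~ [|| y == a, y == b | y == c] ->
  adj a x -> adj a y -> ~~ adj x y.
Proof.
move=> abc def defR xn yn ax ay; apply/negP=> xy.
have hit z : ~~ [|| z == a, z == b | z == c] -> adj a z ->
    [|| adj z d, adj z e | adj z f].
  move=> zn az; have : z \notin far3 d e f.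
    have defR' := defR; rewrite far3_swap in defR'.
    by apply: (far3_sep def abc defR' zn); rewrite adj_sym az.
  by rewrite !inE !negb_and !negbK (adj_sym d) (adj_sym e) (adj_sym f).
have bc : adj b c by case/and3P: abc.
have P := far_P4_free pG bc.
have farT z : ~~ [|| z == a, z == b | z == c] -> adj a z -> z \in far b c.
  rewrite !negb_or inE => /and3P[_ zb zc] az.
  exact: (adj_triangle_unique abc az zb zc).
have farR z : z \in far3 a b c -> z \in far b c.
  by rewrite !inE => /and3P[_ -> ->].
have P6 t t' : t \in far3 a b c -> t' \in far3 a b c -> ~~ p4 t' t x y.
  by move=> /farR tR /farR t'R; apply: P => //; apply: farT.
case/and3P: (defR) => dR eR fR.
move: (P6 d e dR eR) (P6 d f dR fR) (P6 e d eR dR) (P6 e f eR fR)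
  (P6 f d fR dR) (P6 f e fR eR).
case/and3P: def => de ef df.
move: (dG d e f x) (dG d f e x) (dG e f d x) (K4f d e f x).
move: (dG d e f y) (dG d f e y) (dG e f d y) (K4f d e f y).
move: (dG x y a d) (dG x y a e) (dG x y a f) (hit x xn ax) (hit y yn ay).
have ne t : t \in far3 a b c -> [&& ~~ adj a t, a != t, x != t & y != t].
  rewrite inE => /and3P[at_ bt ct]; rewrite at_.
  by rewrite -!negb_or; apply/negP=> /or3P[]/eqP E; move: at_ bt;
    rewrite -E ?ax ?ay // adj_sym; case/and3P: abc => ->.
case/and4P: (ne d dR) => ad nad xd yd; case/and4P: (ne e eR) => ae nae xe ye.
case/and4P: (ne f fR) => af naf xf yf.
by adj_split.
Qed.

Lemma far_triangles_colorable a b c d e f : triangle a b c -> triangle d e f ->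
  [&& d \in far3 a b c, e \in far3 a b c & f \in far3 a b c] -> colorable G 6.
Proof.
move=> abc def defR.
pose T : {set G} := [set x | [|| x == a, x == b, x == c, x == d, x == e | x == f]].
pose W := [set x in far3 a b c | x \notin T].
have WR : W \subset far3 a b c by apply/subsetP=> x; rewrite inE => /andP[].
(* The windmill of a triangle in [W] has a vertex [t] of [W] next to its center. By [far3_nbr] all
   neighbours of [t] are far from [abc], so they lie in the windmill, against [nbhd_not_in_cadj]. *)
have tW : triangle_free W.
  move=> x y z xW yW zW; apply/negP=> xyz; have /subsetP WR' := WR.
  have [w [wR xyzw wP]] := windmill dG (far3_P4_free abc)
    (introT and3P (And3 (WR' x xW) (WR' y yW) (WR' z zW))) xyz.
  have [t tW wt] : exists2 t, t \in W & adj t w.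
    case/and3P: xyzw; rewrite /cadj.
    case/predU1P=> [->|xw _ _]; last by exists x; rewrite // adj_sym.
    by exists y => //; case/and3P: xyz; rewrite adj_sym.
  apply: (nbhd_not_in_cadj wt) => u tu.
  have tR := WR' t tW; have uR : u \in far3 a b c.
    apply: contraT => uR; move: tW; rewrite !inE.
    have := far3_nbr abc def defR uR tR; rewrite adj_sym => /(_ tu).
    by case/or3P=> ->; rewrite ?orbT ?andbF.
  by apply: wP tu _ => //; rewrite /cadj adj_sym wt orbT.
have [c1 c1P] := P4_triangle_free_bipartite (P4_free_sub WR (far3_P4_free abc)) tW.
(* The other neighbours of [a], [b], [c] use 0, 1, 2; the nonadjacent pairs [ad], [be], [cf] use 3,
   4, 5; the bipartite set [W] has no neighbour in the two triangles and reuses 3 and 4. *)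
pose k x := if (x == a) || (x == d) then 3 else if (x == b) || (x == e) then 4
  else if (x == c) || (x == f) then 5 else if adj a x then 0
  else if adj b x then 1 else if adj c x then 2 else 3 + c1 x.
apply: (colorable_bounded (c := k)) => [x | x y xy].
  by rewrite /k; do ![case: ifP => // _]; case: (c1 x).
have kP z : [\/ z \notin T /\ [\/ adj a z /\ k z = 0, adj b z /\ k z = 1
                                | adj c z /\ k z = 2],
               z \in [:: a; d] /\ k z = 3, z \in [:: b; e] /\ k z = 4
             | z \in [:: c; f] /\ k z = 5 \/ z \in W /\ k z = 3 + c1 z].
  rewrite /k; case: ifP => [zad|zad]; first by constructor 2; rewrite !inE zad.
  case: ifP => [zbe|zbe]; first by constructor 3; rewrite !inE zbe.
  case: ifP => [zcf|zcf]; first by constructor 4; left; rewrite !inE zcf.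
  have zT : z \notin T.
    case/norP: (negbT zad) (negbT zbe) (negbT zcf) => za zd /norP[zb ze] /norP[zc zf].
    by rewrite inE !negb_or za zb zc zd ze zf.
  case: ifP => [az|az]; first by constructor 1; split=> //; constructor 1.
  case: ifP => [bz|bz]; first by constructor 1; split=> //; constructor 2.
  case: ifP => [cz|cz]; first by constructor 1; split=> //; constructor 3.
  by constructor 4; right; split=> //; rewrite inE zT andbT inE az bz cz.
have indep u v : u \notin T -> v \notin T ->
    [|| adj a u && adj a v, adj b u && adj b v | adj c u && adj c v] ->
    ~~ adj u v.
  rewrite !inE !negb_or => /and5P[ua ub uc _ _] /and5P[va vb vc _ _].
  case/or3P=> /andP[uu vv].
  - apply: (far_triangles_indep abc def defR) uu vv; rewrite ?negb_or ?ua ?ub ?uc ?va ?vb ?vc //.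
  - rewrite triangle_rot far3_rot in abc defR.
    apply: (far_triangles_indep abc def defR) uu vv; rewrite ?negb_or ?ua ?ub ?uc ?va ?vb ?vc //.
  rewrite -triangle_rot -far3_rot in abc defR.
  apply: (far_triangles_indep abc def defR) uu vv; rewrite ?negb_or ?ua ?ub ?uc ?va ?vb ?vc //.
have sepT u v : u \in T -> v \in W -> ~~ adj u v.
  move=> uT; rewrite inE => /andP[vR vT]; apply: contraTN (vR) => uv.
  have vdef : ~~ [|| v == d, v == e | v == f].
    by apply: contra vT; rewrite inE => /or3P[]->; rewrite ?orbT.
  move: uT; rewrite inE; case/or4P=> [/eqP uE|/eqP uE|/eqP uE|uE].
  - by rewrite inE -uE uv.
  - by rewrite inE -uE uv andbF.
  - by rewrite inE -uE uv !andbF.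
  apply: (far3_sep abc def defR vdef).
  by case/or3P: uE => /eqP<-; rewrite (adj_sym v u) uv ?orbT.
have inT u : u \in [:: a; b; c; d; e; f] -> u \in T by rewrite !inE.
have defn : [&& ~~ adj a d, ~~ adj b e & ~~ adj c f].
  by case/and3P: defR; rewrite !inE => /and3P[-> _ _] /and3P[_ -> _] /and3P[_ _ ->].
case/and3P: defn => ad be cf.
have pairT u v : ~~ adj u v -> {in [:: u; v] &, forall z w, ~~ adj z w}.
  move=> uv z w; rewrite !inE => /pred2P[]-> /pred2P[]->;
    by rewrite ?adj_irrefl // adj_sym.
have subT u v : u \in T -> v \in T -> {subset [:: u; v] <= T}.
  by move=> uT vT z; rewrite !inE => /pred2P[]->; [move: uT|move: vT]; rewrite inE.
have [adT beT cfT] : [/\ {subset [:: a; d] <= T}, {subset [:: b; e] <= T} &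
    {subset [:: c; f] <= T}].
  by split; apply: subT; apply: inT; rewrite !inE eqxx ?orbT.
apply/eqP=> kxy; move: xy; apply/negP.
case: (kP x) => [[xT [[ax kx]|[bx kx]|[cx kx]]]|[xad kx]|[xbe kx]|[[xcf kx]|[xW kx]]];
case: (kP y) => [[yT [[ay ky]|[by_ ky]|[cy ky]]]|[yad ky]|[ybe ky]|[[ycf ky]|[yW ky]]];
  move: kxy; rewrite kx ky => kxy;
  try first [by case: (c1 x) kxy | by case: (c1 y) kxy];
  try (by apply: indep; rewrite // ?ax ?ay ?bx ?by_ ?cx ?cy ?orbT);
  try first [by apply: (pairT _ _ ad) | by apply: (pairT _ _ be) | by apply: (pairT _ _ cf)];
  try (by apply: sepT; auto); try (by rewrite adj_sym; apply: sepT; auto).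
apply/negP=> xy; have := c1P x y xW yW xy; apply/negP; rewrite negbK; apply/eqP.
by move/eqP: kxy; rewrite eqn_add2l; case: (c1 x) (c1 y) => [] [].
Qed.

(** * Every edge has a far triangle, but no two triangles are far from each other *)

Section NoFarTriangles.

Hypothesis far_tri : forall a b, adj a b ->
  exists x y z, [/\ x \in far a b, y \in far a b, z \in far a b & triangle x y z].
Hypothesis no_far3_tri : forall a b c d e f, triangle a b c -> triangle d e f ->
  ~~ [&& d \in far3 a b c, e \in far3 a b c & f \in far3 a b c].

Lemma far_far3 a b c x : x \in far a b -> ~~ adj c x -> x \in far3 a b c.
Proof. by rewrite !inE andbA => ->. Qed.

Lemma far3_far a b c x : x \in far3 a b c -> x \in far a b.
Proof. by rewrite !inE andbA => /andP[]. Qed.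

(** A triangle far from [ab] is not far from [abc], so [c] is adjacent to one of its vertices, and
    to only one, as there is no diamond and no K4. The absence of a K4 also puts the center into the
    triangle. *)
Lemma far_windmill a b c : triangle a b c -> exists w r s z,
  [/\ [&& adj c w, w \in far a b, r \in far3 a b c & s \in far3 a b c],
      triangle w r s, z \in [:: w; r; s] &
      {in far a b &, forall u v, adj u v -> cadj z u -> cadj z v}].
Proof.
move=> abc; have /and3P[ab bc ac] := abc.
have two x y t : x \in far a b -> y \in far a b -> t \in far a b ->
    triangle x y t -> adj c x -> ~~ adj c y && ~~ adj c t.
  rewrite !inE => /andP[ax bx] /andP[ay by_] /andP[at_ bt] xyt cx.
  have xc : c != t by apply: contraNneq at_ => <-.
  have yc : c != y by apply: contraNneq ay => <-.
  case/and3P: xyt => xy yt xt.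
  by move: (dG x y t c) (dG x t y c) (K4f x y t c); adj_split.
have [x [y [t [xF yF tF xyt]]]] := far_tri ab.
have [w [r [s [wF rF sF wrs cw]]]] : exists w r s,
    [/\ w \in far a b, r \in far a b, s \in far a b, triangle w r s & adj c w].
  have [cx|cx] := boolP (adj c x); first by exists x, y, t.
  have [cy|cy] := boolP (adj c y); first by exists y, t, x; rewrite -triangle_rot.
  have [ct|ct] := boolP (adj c t); first by exists t, x, y; rewrite triangle_rot.
  by have := no_far3_tri abc xyt; rewrite !far_far3.
have /andP[cr cs] := two _ _ _ wF rF sF wrs cw.
have [z [zF zwrs zP]] := windmill dG (far_P4_free pG ab)
  (introT and3P (And3 wF rF sF)) wrs.
exists w, r, s, z; split=> //; first by rewrite cw wF !far_far3.
rewrite !inE; case/and3P: zwrs; rewrite /cadj.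
case/predU1P=> [->|zw]; first by rewrite eqxx.
case/predU1P=> [->|zr]; first by rewrite eqxx !orbT.
case/predU1P=> [->|zs]; first by rewrite eqxx !orbT.
by case/negP: (K4f w r s z); rewrite wrs zw zr zs.
Qed.

(** By [far3_edge_hit] for the path from [c] through [w] to [r], the edge [uv] is joined to [w] or
    [r], hence belongs to the same windmill. *)
Lemma far3_edge_center a b c w r s z u v : triangle a b c ->
  [&& adj c w, w \in far a b, r \in far3 a b c & s \in far3 a b c] ->
  triangle w r s -> z \in [:: w; r; s] ->
  {in far a b &, forall u v, adj u v -> cadj z u -> cadj z v} ->
  u \in far3 a b c -> v \in far3 a b c -> adj u v -> cadj z u && cadj z v.
Proof.
move=> abc /and4P[cw wF rR sR] wrs zin zP uR vR uv.
have [uF vF rF sF] : [/\ u \in far a b, v \in far a b, r \in far a b & s \in far a b].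
  by split; apply: far3_far; eassumption.
have zNwrs : [&& cadj z w, cadj z r & cadj z s].
  by move: wrs zin; rewrite !inE => wrs /or3P[]/eqP->; move: wrs; adj_split.
case/and3P: zNwrs => zw zr zs.
have zuv : cadj z u = cadj z v.
  by apply/idP/idP; apply: zP => //; rewrite adj_sym.
rewrite -zuv andbb; have /and3P[wr _ _] := wrs.
have [wa wb] : w != a /\ w != b.
  move: wF; rewrite inE; case/and3P: abc => ab _ _ /andP[aw bw].
  by split; [apply: contraNneq bw => -> | apply: contraNneq aw => ->]; rewrite // adj_sym.
have cab : triangle c a b by rewrite triangle_rot.
have E : far3 c a b = far3 a b c by rewrite far3_rot.
have := far3_edge_hit cab cw wa wb; rewrite E => /(_ r u v rR wr uR vR uv).
case/or4P; rewrite adj_sym => h.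
- exact: (zP w u wF uF h zw).
- exact: (zP r u rF uF h zr).
- rewrite zuv; exact: (zP w v wF vF h zw).
by rewrite zuv; exact: (zP r v rF vF h zr).
Qed.

(** The vertices [w] and [w'] differ, since only one is adjacent to [a]; as common neighbours of [r]
    and [s] they would be adjacent and form a K4. *)
Lemma far3_common_edge a b c w w' r s : triangle a b c ->
  w \in far a b -> adj c w -> w' \in far b c -> adj a w' ->
  triangle w r s -> triangle w' r s -> False.
Proof.
move=> abc; rewrite !inE => /andP[aw bw] cw /andP[bw' cw'] aw'.
have ww' : w != w' by apply: contraNneq aw => ->.
by move: (dG r s w w') (K4f w r s w'); adj_split.
Qed.

Lemma triangle_swap x y z : triangle x y z = triangle x z y.
Proof. by adj_split. Qed.

Definition windmill_center a b c r s : Prop :=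
  [/\ r \in far3 a b c, s \in far3 a b c, adj r s,
      exists2 w, triangle w r s & (w \in far a b) && adj c w &
      {in far a b &, forall u v, adj u v -> cadj r u -> cadj r v}].

(** The center is not [w]: the windmill far from [bc] has an edge [r's'] in [far3 a b c], which both
    [w] and [w'] would complete to a triangle, against [far3_common_edge]. If the center is [s],
    then [r] and [s] are exchanged. *)
Lemma far_windmill_center a b c : triangle a b c -> exists r s, windmill_center a b c r s.
Proof.
move=> abc; have bca : triangle b c a by rewrite -triangle_rot.
have Ea : far3 b c a = far3 a b c by rewrite -far3_rot.
have [w [r [s [z [H wrs zin zP]]]]] := far_windmill abc.
have [w' [r' [s' [_ [H' w'rs' _ _]]]]] := far_windmill bca.
rewrite Ea in H'; case/and4P: H' => aw' w'F r'R s'R.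
have r's' : adj r' s' by case/and3P: w'rs'.
have := far3_edge_center abc H wrs zin zP r'R s'R r's'.
case/and4P: H => cw wF rR sR /andP[zr' zs'].
have [wr rs ws] := and3P wrs.
move: zin zP zr' zs'; rewrite !inE => /or3P[]/eqP-> zP zr' zs'.
- have wR : w \notin far3 a b c by rewrite inE cw !andbF.
  have ww t : t \in far3 a b c -> w != t by apply: contraTneq => <-.
  case: (@far3_common_edge a b c w w' r' s' abc) => //.
  by move: zr' zs'; rewrite /triangle /cadj !(negbTE (ww _ _)) //= => -> ->; rewrite r's'.
- by exists r, s; split=> //; exists w; rewrite ?wF.
by exists s, r; split=> //; [rewrite adj_sym | exists w; rewrite ?wF // -triangle_swap].
Qed.

(** An edge of the windmill that avoids [r] would form with [r] a triangle far from [abc]. *)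
Lemma windmill_center_nbrs a b c r s u v : triangle a b c ->
  windmill_center a b c r s ->
  u \in far3 a b c -> v \in far3 a b c -> adj u v -> (r == u) || (r == v).
Proof.
move=> abc [rR sR rs [w wrs /andP[wF cw]] rP] uR vR uv.
have H : [&& adj c w, w \in far a b, r \in far3 a b c & s \in far3 a b c].
  by rewrite cw wF rR sR.
have rin : r \in [:: w; r; s] by rewrite !inE eqxx orbT.
have := far3_edge_center abc H wrs rin rP uR vR uv.
apply: contraTT; rewrite negb_or /cadj => /andP[/negbTE-> /negbTE->] /=.
apply/negP=> /andP[ru rv]; have := @no_far3_tri a b c r u v abc.
by rewrite rR uR vR /triangle ru uv rv => /(_ isT).
Qed.

(** Both [rs] and [r's'] are edges of [far3 a b c], so each contains both centers. If the centers
    differ, the two edges coincide, against [far3_common_edge]. *)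
Lemma windmill_center_eq a b c r s r' s' : triangle a b c ->
  windmill_center a b c r s -> windmill_center b c a r' s' -> r = r'.
Proof.
move=> abc C C'; have bca : triangle b c a by rewrite -triangle_rot.
have [rR sR rs [w wrs /andP[wF cw]] _] := C.
have [r'R s'R r's' [w' w'rs' /andP[w'F aw']] _] := C'.
have Ea : far3 b c a = far3 a b c by rewrite -far3_rot.
have := windmill_center_nbrs bca C'; rewrite Ea => /(_ _ _ rR sR rs).
rewrite Ea in r'R s'R.
case/orP=> [/eqP // | /eqP r's].
have := windmill_center_nbrs abc C r'R s'R r's'.
case/orP=> [/eqP // | /eqP rs'].
case: (far3_common_edge abc wF cw w'F aw' wrs).
by rewrite triangle_swap -r's rs'.
Qed.

(** The three windmills have a common center [r]. A neighbour [u] of [s] is adjacent to at most one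
    of [a], [b], [c], hence far from one of the edges [ab], [bc], [ca], and so in the closed
    neighbourhood of [r]. *)
Lemma no_triangle a b c : ~~ triangle a b c.
Proof.
apply/negP=> abc; have bca : triangle b c a by rewrite -triangle_rot.
have cab : triangle c a b by rewrite triangle_rot.
have [r [s C]] := far_windmill_center abc.
have [r' [s' C']] := far_windmill_center bca.
have [r'' [s'' C'']] := far_windmill_center cab.
have r'E := windmill_center_eq abc C C'; have r''E := windmill_center_eq bca C' C''.
rewrite -{}r''E -{}r'E {r' r''} in C' C''.
have [rR sR rs _ P] := C; have [_ _ _ _ P'] := C'; have [_ _ _ _ P''] := C''.
have sr : adj s r by rewrite adj_sym.
apply: (nbhd_not_in_cadj sr) => u su.
have crs : cadj r s by rewrite /cadj rs orbT.
have [ua ub uc] : [/\ u != a, u != b & u != c].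
  by split; apply: contraTneq sR => <-; rewrite !inE (adj_sym u s) su ?andbF.
have [sab sbc sca] : [/\ s \in far a b, s \in far b c & s \in far c a].
  by move: sR; rewrite !inE => /and3P[-> -> ->].
have [au|au] := boolP (adj a u).
  by apply: (P' s u) su crs => //; rewrite inE (adj_triangle_unique abc).
have [bu|bu] := boolP (adj b u); last by apply: (P s u) su crs; rewrite // inE au.
by apply: (P'' s u) su crs => //; rewrite inE (adj_triangle_unique bca).
Qed.

End NoFarTriangles.

Lemma K4_free_colorable_deg : colorable G 6.
Proof.
have [[a [b [ab tab]]]|H] :
    (exists a b, adj a b /\ triangle_free (far a b)) \/
    (forall a b, adj a b -> exists x y z,
       [/\ x \in far a b, y \in far a b, z \in far a b & triangle x y z]).
- case: (pickP [pred p : G * G | adj p.1 p.2 &&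
      ~~ [exists x in far p.1 p.2, exists y in far p.1 p.2, exists z in far p.1 p.2,
          triangle x y z]]).
    case=> a b /= /andP[ab nt]; left; exists a, b; split=> // x y z xF yF zF.
    apply: contra nt => xyz; apply/exists_inP; exists x => //.
    by apply/exists_inP; exists y => //; apply/exists_inP; exists z.
  move=> p0; right=> a b ab; have := p0 (a, b); rewrite /= ab /= => /negbFE.
  case/exists_inP=> x xF /exists_inP[y yF /exists_inP[z zF xyz]].
  by exists x, y, z.
- exact: far_triangle_free_colorable tab.
have [[a [b [c [d [e [f [abc def defR]]]]]]]|N] :
    (exists a b c d e f, [/\ triangle a b c, triangle d e f &
       [&& d \in far3 a b c, e \in far3 a b c & f \in far3 a b c]]) \/
    (forall a b c d e f, triangle a b c -> triangle d e f ->
      ~~ [&& d \in far3 a b c, e \in far3 a b c & f \in far3 a b c]).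
- case: (pickP [pred p : (G * G * G) * (G * G * G) |
      [&& triangle p.1.1.1 p.1.1.2 p.1.2, triangle p.2.1.1 p.2.1.2 p.2.2 &
        [&& p.2.1.1 \in far3 p.1.1.1 p.1.1.2 p.1.2,
            p.2.1.2 \in far3 p.1.1.1 p.1.1.2 p.1.2 &
            p.2.2 \in far3 p.1.1.1 p.1.1.2 p.1.2]]]).
    case=> [[[a b] c] [[d e] f]] /= /and3P[abc def defR].
    by left; exists a, b, c, d, e, f.
  move=> p0; right=> a b c d e f abc def; have := p0 (a, b, c, (d, e, f)).
  by rewrite /= abc def /= => ->.
- exact: far_triangles_colorable abc def defR.
(* Every edge would have a far triangle, and there is no triangle, so there is no edge. *)
apply: (colorable_bounded (c := fun=> 0)) => // x y xy.
by have [u [v [w [_ _ _]]]] := H x y xy; rewrite (negbTE (no_triangle H N u v w)).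
Qed.

End CliqueNumber3.

(** * Deleting a vertex of small degree *)

Section Deletion.

Variables (G : sgraph) (v : G).

Lemma del_vertex_colorable (k : nat) :
  colorable (induced [set~ v]) k -> #|nbhd v| < k -> colorable G k.
Proof.
move=> /colorableP[c cP] vk.
pose c' (x : G) : 'I_k := if @insub _ _ {x : G | x \in [set~ v]} x is Some y then c y
  else Ordinal (leq_ltn_trans (leq0n _) vk).
have [i /imsetP iN] : exists i, i \notin c' @: nbhd v.
  apply/existsP; apply: contraLR (vk); rewrite negb_exists -leqNgt => /forallP H.
  rewrite -[k]card_ord -cardsT; apply: leq_trans (leq_imset_card c' _).
  by apply/subset_leq_card/subsetP=> i _; have := H i; rewrite negbK.
apply/colorableP; exists (fun x => if x == v then i else c' x) => x y xy.
have [xv|xv] := eqVneq x v.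
  rewrite ifN; last by rewrite -xv eq_sym adj_neq.
  by apply/eqP=> iE; apply: iN; exists y; rewrite // inE -xv.
have [yv|yv] := eqVneq y v.
  by apply/eqP=> iE; apply: iN; exists x; rewrite // inE -yv adj_sym.
rewrite /c'; case: insubP => [x' _ xE|]; last by rewrite !inE xv.
case: insubP => [y' _ yE|]; last by rewrite !inE yv.
by apply: cP; rewrite /= /induced_rel xE yE.
Qed.

Lemma del_vertex_card : #|induced [set~ v]| < #|G|.
Proof.
rewrite card_sig (eq_card (B := mem [set~ v])) // cardsC1 prednK //.
by apply/card_gt0P; exists v.
Qed.

End Deletion.

Lemma induced_P2P4_free (G : sgraph) (S : {set G}) :
  P2P4_free G -> P2P4_free (induced S).
Proof. by move=> pG u v a b c d; apply: pG. Qed.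

Lemma induced_diamond_free (G : sgraph) (S : {set G}) :
  diamond_free G -> diamond_free (induced S).
Proof. by move=> dG x y u v; have := dG (val x) (val y) (val u) (val v). Qed.

Lemma K4_free_colorable (G : sgraph) : P2P4_free G -> diamond_free G ->
  (forall x y z w : G, ~~ [&& triangle x y z, adj w x, adj w y & adj w z]) ->
  colorable G 6.
Proof.
have [n] := ubnP #|G|; elim: n G => // n IHn G; rewrite ltnS => Gn pG dG kG.
have [/forallP deg6|] := boolP [forall x : G, 6 <= #|nbhd x|].
  exact: K4_free_colorable_deg.
rewrite negb_forall => /existsP[v]; rewrite -ltnNge => v6.
apply: del_vertex_colorable v6; apply: IHn.
- exact: leq_trans (del_vertex_card v) Gn.
- exact: induced_P2P4_free.
- exact: induced_diamond_free.
by move=> x y z w; apply: (kG (val x)).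
Qed.

(** * Clique number at least 4 *)

Section LargeClique.

Variables (G : sgraph) (k : nat) (q : 'I_k -> G).
Implicit Types (r s u v w x y z t : G) (X Y D : {set G}) (i j l : 'I_k).
Hypotheses (pG : P2P4_free G) (dG : diamond_free G).
Hypothesis k_ge4 : 4 <= k.
Hypothesis q_adj : forall i j, i != j -> adj (q i) (q j).
Hypothesis clique_le : forall S : {set G}, clique S -> #|S| <= k.

Lemma pairwise_adj_le (p : seq G) : pairwise (@adj G) p -> size p <= k.
Proof.
move=> adj_p; have Up : uniq p := pairwise_uniq (@adj_irrefl G) adj_p.
rewrite -(card_uniqP Up) -cardsE; apply: clique_le; apply/cliqueP=> x y.
rewrite !inE => xp yp xy; have : pairwise (@cadj G) p.
  by apply: sub_pairwise adj_p => u v; rewrite /cadj => ->; rewrite orbT.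
rewrite pairwise_all2rel; last by move=> u v; rewrite cadj_sym.
  by move/allrelP/(_ x y xp yp); rewrite /cadj (negbTE xy).
by move=> u; rewrite /cadj eqxx.
Qed.

Definition outer : {set G} := [set x | x \notin codom q].

Lemma outer_neq x i : x \in outer -> x != q i.
Proof. by rewrite inE; apply: contraNneq => ->; apply: codom_f. Qed.

(** With two neighbours in the clique, [x] would be adjacent to all of it by diamond-freeness,
    giving a clique of size [k + 1]. *)
Lemma label_unique x i j :
  x \in outer -> adj (q i) x -> adj (q j) x -> i = j.
Proof.
move=> xH ix jx; apply/eqP; apply: contraT => ij.
have xq l : adj x (q l).
  have [->|li] := eqVneq l i; first by rewrite adj_sym.
  have [->|lj] := eqVneq l j; first by rewrite adj_sym.
  have := dG (q i) (q j) x (q l); rewrite (negbTE (outer_neq l xH)) /=.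
  by rewrite !(adj_sym x) !q_adj ?ix ?jx.
have := @pairwise_adj_le (x :: codom q); rewrite /= size_codom card_ord.
rewrite ltnn; apply; apply/andP; split.
  by apply/allP=> _ /codomP[l ->].
rewrite codomE pairwise_map; have := enum_uniq 'I_k.
by rewrite uniq_pairwise; apply: sub_pairwise => l m; apply: q_adj.
Qed.

Definition k0 : 'I_k := Ordinal (leq_trans (isT : 0 < 4) k_ge4).

(* Junk value k0 on vertices without neighbour in the clique. *)
Definition label x : 'I_k := odflt k0 [pick i | adj (q i) x].

Lemma labelP x i : x \in outer -> adj (q i) x -> i = label x.
Proof.
move=> xH ix; rewrite /label; case: pickP => [j jx | /(_ i)]; last by rewrite ix.
exact: label_unique xH ix jx.
Qed.

Definition labelled x : bool := adj (q (label x)) x.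

Lemma labelledPn x i : ~~ labelled x -> ~~ adj (q i) x.
Proof.
rewrite /labelled /label; case: pickP => [j jx | H _]; first by rewrite jx.
by rewrite H.
Qed.

(** * Extending the coloring [q i |-> i] of the clique *)

Definition list_coloring X (c : G -> 'I_k) : Prop :=
  {in X, forall x i, adj (q i) x -> c x != i} /\
  {in X &, forall x y, adj x y -> c x != c y}.

Definition list_colorable X : Prop := exists c, list_coloring X c.

Lemma list_colorable_colorable : list_colorable outer -> colorable G k.
Proof.
case=> c [cq cP]; have q_inj : injective q.
  by move=> i j ij; apply/eqP; apply: contraT => /q_adj; rewrite ij adj_irrefl.
pose c' x := if [pick i | q i == x] is Some i then i else c x.
have c'q i : c' (q i) = i.
  by rewrite /c'; case: pickP => [j /eqP/q_inj // | /(_ i)]; rewrite eqxx.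
have c'H x : x \in outer -> c' x = c x.
  move=> xH; rewrite /c'; case: pickP => // i /eqP ix.
  by have := outer_neq i xH; rewrite ix eqxx.
have outerPn x : x \notin outer -> exists i, x = q i.
  by rewrite inE negbK => /codomP.
apply/colorableP; exists c' => x y xy.
have [xH|/outerPn[i xE]] := boolP (x \in outer);
have [yH|/outerPn[j yE]] := boolP (y \in outer).
- by rewrite !c'H // cP.
- by rewrite yE c'q c'H // cq // -yE adj_sym.
- by rewrite xE c'q c'H // eq_sym cq // -xE.
by rewrite xE yE !c'q; apply: contraTneq xy => ij; rewrite xE yE ij adj_irrefl.
Qed.

Lemma list_colorable_union X D : D \subset X ->
  {in D & X :\: D, forall x y, ~~ adj x y} ->
  list_colorable D -> list_colorable (X :\: D) -> list_colorable X.
Proof.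
move=> DX sep [c1 [c1q c1P]] [c2 [c2q c2P]].
have inXD x : x \in X -> x \notin D -> x \in X :\: D by rewrite inE => -> ->.
exists (fun x => if x \in D then c1 x else c2 x); split=> [x xX i ix | x y xX yX xy].
  by case: ifP => xD; [apply: c1q | apply: c2q => //; rewrite inXD ?xD].
case: ifPn => xD; case: ifPn => yD.
- exact: c1P.
- by have := sep x y xD (inXD y yX yD); rewrite xy.
- by have := sep y x yD (inXD x xX xD); rewrite adj_sym xy.
by apply: c2P => //; apply: inXD.
Qed.

(** Only its label is forbidden to a vertex, so two colors per side suffice: 0, 1 on one side and 2,
    3 on the other. *)
Lemma bipartite_list_colorable X : X \subset outer ->
  P4_free X -> triangle_free X -> list_colorable X.
Proof.
move=> /subsetP XH pX tX; have [b bP] := P4_triangle_free_bipartite pX tX.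
pose o m (mk : m < 4) : 'I_k := Ordinal (leq_trans mk k_ge4).
pose i0 := @o 0 isT; pose i1 := @o 1 isT; pose i2 := @o 2 isT; pose i3 := @o 3 isT.
exists (fun x => if b x then if label x == i0 then i1 else i0
                 else if label x == i2 then i3 else i2); split.
  move=> x /XH xH i /(labelP xH)->.
  case: (b x).
    by have [->|] := eqVneq (label x) i0; rewrite // eq_sym.
  by have [->|] := eqVneq (label x) i2; rewrite // eq_sym.
move=> x y xX yX /(bP x y xX yX).
by case: (b x); case: (b y) => //= _; case: ifP => _; case: ifP.
Qed.

Lemma exists_color (S : {set 'I_k}) : #|S| < k -> exists i, i \notin S.
Proof.
move=> Sk; apply/existsP; apply: contraLR Sk; rewrite negb_exists -leqNgt.
move=> /forallP H; rewrite -[k in k <= _]card_ord -cardsT.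
by apply/subset_leq_card/subsetP=> i _; have := H i; rewrite negbK.
Qed.

(* Colors are given greedily. Inside a blade this can only fail at the last
   vertex v, when the single color left is its own label i; since the blade is
   not contained in the neighbourhood of q i, some vertex of the blade can take
   the color i and hand its own color over to v. *)
Lemma nbhd_list_colorable z (a : 'I_k) Y : z \in outer ->
  Y \subset outer :&: nbhd z ->
  exists2 c, list_coloring Y c & {in Y, forall x, c x != a}.
Proof.
move=> zH; have [n] := ubnP #|Y|; elim: n Y => // n IHn Y; rewrite ltnS => Yn YH.
have [->|[v vY]] := set_0Vmem Y.
  by exists (fun=> k0); [split=> x | move=> x]; rewrite inE.
have inY x : x \in Y -> x \in outer /\ adj z x.
  by move/(subsetP YH); rewrite 2!inE => /andP[]; rewrite inE.
have [||c [cq cP] ca] := IHn (Y :\ v).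
- by apply: leq_trans Yn; rewrite [X in _ < X](cardsD1 v) vY.
- by apply: subset_trans YH; apply: subsetDl.
have [vH zv] := inY v vY.
(* [v |: B] is the blade of [v]: a clique without neighbours in the rest of [Y]. *)
pose B := nbhd v :&: (Y :\ v).
have BY u : u \in B -> [/\ u \in Y, u != v & adj v u].
  by rewrite !inE => /and3P[].
have nbrB u x : u \in Y -> adj v u -> x \in Y -> adj u x -> x != v -> x \in B.
  move=> /inY[_ zu] vu xY ux xv; have [_ zx] := inY x xY.
  by rewrite !inE xv xY !andbT; move: (dG u z v x); adj_split.
have Bcl : {in B &, forall u w, u != w -> adj u w}.
  move=> u w /BY[uY uv vu] /BY[wY wv vw] uw; have [_ zu] := inY u uY.
  by have [_ zw] := inY w wY; move: (dG v z u w); adj_split.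
pose F := ~: (a |: c @: B).
have extend c' : (forall i, adj (q i) v -> c' v != i) -> c' v != a ->
    {in Y :\ v, forall x i, adj (q i) x -> c' x != i} ->
    {in Y :\ v, forall x, c' x != a} ->
    {in Y :\ v &, forall x y, adj x y -> c' x != c' y} ->
    {in B, forall x, c' x != c' v} ->
    exists2 c, list_coloring Y c & {in Y, forall x, c x != a}.
  move=> c'v c'va c'q c'a c'P c'B; exists c'; last first.
    move=> x xY; have [->//|xv] := eqVneq x v.
    by apply: c'a; rewrite !inE xv.
  have inYv x : x \in Y -> x != v -> x \in Y :\ v by rewrite !inE => -> ->.
  split=> [x xY i|x y xY yY xy].
    have [->|xv] := eqVneq x v; first exact: c'v.
    by apply: c'q; apply: inYv.
  have [xv|xv] := eqVneq x v; have [yv|yv] := eqVneq y v.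
  - by rewrite xv yv adj_irrefl in xy.
  - by rewrite xv eq_sym; apply: c'B; rewrite !inE yv yY -xv xy.
  - by rewrite yv; apply: c'B; rewrite !inE xv xY -yv adj_sym xy.
  by apply: c'P => //; apply: inYv.
have [[i iF iv]|Flab] : (exists2 i, i \in F & ~~ adj (q i) v) \/
    {in F, forall i, adj (q i) v}.
- have [/exists_inP|] := boolP [exists i in F, ~~ adj (q i) v]; first by left.
  by rewrite negb_exists_in => /forall_inP H; right=> i /H; rewrite negbK.
- move: iF; rewrite !inE negb_or => /andP[ia icB].
  apply: (extend (fun x => if x == v then i else c x)); rewrite ?eqxx //.
  + by move=> j; apply: contraTneq => <-.
  + by move=> x xY j; move: (xY); rewrite !inE => /andP[/negbTE-> _]; apply: cq.
  + by move=> x xY; move: (xY); rewrite !inE => /andP[/negbTE-> _]; apply: ca.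
  + move=> x y xY yY xy; move: (xY) (yY).
    by rewrite !inE => /andP[/negbTE-> _] /andP[/negbTE-> _]; apply: cP.
  move=> x xB; have [_ /negbTE-> _] := BY x xB.
  by apply: contraNneq icB => <-; apply: imset_f.
(* All free colors are labels of [v], so only one is free, and [z], [v] and [B] form a clique of
   size exactly [k]. *)
have vzB : #|B|.+2 <= k.
  have -> : #|B|.+2 = #|z |: (v |: B)|.
    rewrite !cardsU1 !inE eqxx /= (negbTE (adj_neq zv)) /= adj_irrefl /=.
    rewrite (_ : z \in Y = false) ?andbF //.
    by apply/negP=> /inY[_]; rewrite adj_irrefl.
  apply: clique_le; apply/cliqueP=> x y; rewrite !in_setU1.
  have zB u : u \in B -> adj z u by case/BY=> /inY[].
  have vB u : u \in B -> adj v u by case/BY.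
  case/or3P=> [/eqP->|/eqP->|xB] /or3P[/eqP->|/eqP->|yB]; rewrite ?eqxx // => xy.
  - exact: zB.
  - by rewrite adj_sym.
  - exact: vB.
  - by rewrite adj_sym zB.
  - by rewrite adj_sym vB.
  exact: Bcl.
have Fcard : #|F| = k - #|a |: c @: B| by rewrite cardsCs setCK card_ord.
have [i iF] : exists i, i \in F.
  have [|i iN] := @exists_color (a |: c @: B).
    apply: leq_ltn_trans vzB; rewrite cardsU1; case: (_ \notin _).
      by rewrite add1n ltnS leq_imset_card.
    by rewrite add0n (leq_trans (leq_imset_card _ _)).
  by exists i; rewrite inE.
have iv := Flab i iF.
have F1 : #|F| <= 1.
  by apply/card_le1_eqP=> j l /Flab jv /Flab lv; apply: label_unique vH _ _.
have B_ge : k <= #|B|.+2.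
  move: F1; rewrite Fcard leq_subLR addn1 => /leq_trans->//; rewrite ltnS.
  rewrite cardsU1; case: (_ \notin _); first by rewrite add1n ltnS leq_imset_card.
  by rewrite add0n (leq_trans (leq_imset_card _ _)).
(* Otherwise [q i] would be adjacent to [v], to [B] and, by diamond-freeness, to [z], a clique of
   size [k + 1]. *)
have [u uB iu] : exists2 u, u \in B & ~~ adj (q i) u.
  have [/exists_inP//|] := boolP [exists u in B, ~~ adj (q i) u].
  rewrite negb_exists_in => /forall_inP H.
  have iB u : u \in B -> adj (q i) u by move/H; rewrite negbK.
  have [u uB] : exists u, u \in B.
    by apply/set0Pn; rewrite -card_gt0 -ltnS -ltnS (leq_trans _ B_ge) // (leq_trans _ k_ge4).
  have [uY uv vu] := BY u uB; have [uH zu] := inY u uY.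
  have zi : adj (q i) z.
    have := iB u uB; move: (dG u v z (q i)) (outer_neq i zH) => + zq.
    by move=> + iu; adj_split.
  have : #|q i |: (z |: (v |: B))| <= k.
    apply: clique_le; apply/cliqueP=> x y; rewrite !in_setU1.
    have zB w : w \in B -> adj z w by case/BY=> /inY[].
    have vB w : w \in B -> adj v w by case/BY.
    case/or4P=> [/eqP->|/eqP->|/eqP->|xB] /or4P[/eqP->|/eqP->|/eqP->|yB];
      rewrite ?eqxx // => xy;
      by [exact: iB | exact: zB | exact: vB | exact: Bcl
         | rewrite adj_sym // ?iB ?zB ?vB].
  suff -> : #|q i |: (z |: (v |: B))| = #|B|.+3 by rewrite ltnNge B_ge.
  rewrite !cardsU1 !inE eqxx /= (negbTE (adj_neq zv)) /= adj_irrefl /=.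
  have qY : q i \in Y = false.
    by apply/negP=> /inY[qH _]; have := outer_neq i qH; rewrite eqxx.
  rewrite (_ : z \in Y = false) ?qY ?andbF ?orbF //.
    by rewrite (eq_sym _ z) (eq_sym _ v) !(negbTE (outer_neq _ _)).
  by apply/negP=> /inY[_]; rewrite adj_irrefl.
have [uY uv vu] := BY u uB; have [uH zu] := inY u uY.
move: iF; rewrite !inE negb_or => /andP[ia icB].
have uYv : u \in Y :\ v by rewrite !inE uv uY.
have cB x : x \in B -> c x != i.
  by move=> xB; apply: contraNneq icB => <-; apply: imset_f.
have Yv x : x \in Y :\ v -> (x == v) = false.
  by rewrite !inE => /andP[/negbTE].
apply: (extend (fun x => if x == v then c u else if x == u then i else c x)).
- by move=> j jv; rewrite eqxx (label_unique vH jv iv); apply: cB.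
- by rewrite eqxx; apply: ca.
- move=> x xYv j; rewrite (Yv x) //; have [->|xu] := eqVneq x u; last exact: cq.
  by move=> ju; apply: contraNneq iu => ->.
- move=> x xYv; rewrite (Yv x) //; case: ifP => // _; exact: ca.
- move=> x y xYv yYv xy; rewrite (Yv x) // (Yv y) //.
  have [xY xv] : x \in Y /\ x != v by move: xYv; rewrite !inE => /andP[].
  have [yY yv] : y \in Y /\ y != v by move: yYv; rewrite !inE => /andP[].
  have [xu|xu] := eqVneq x u; have [yu|yu] := eqVneq y u.
  + by rewrite xu yu adj_irrefl in xy.
  + by rewrite eq_sym; apply: cB; apply: (nbrB u y uY vu yY) => //; rewrite -xu.
  + by apply: cB; apply: (nbrB u x uY vu xY) => //; rewrite adj_sym -yu.
  exact: cP.
move=> x xB; rewrite eqxx; have [_ xv _] := BY x xB; rewrite (negbTE xv).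
have [xu|xu] := eqVneq x u; first by rewrite eq_sym cB.
have xYv : x \in Y :\ v by move: xB; rewrite inE => /andP[].
by apply: cP => //; apply: Bcl.
Qed.

(** A color [a] other than the label of [z] is reserved for [z]. *)
Lemma dominated_list_colorable D z : D \subset outer -> z \in D ->
  {in D, forall x, cadj z x} -> list_colorable D.
Proof.
move=> DH zD zdom; have zH := subsetP DH z zD.
have [a az] : exists a, ~~ adj (q a) z.
  have [|a] := @exists_color [set label z].
    by rewrite cards1 (leq_trans _ k_ge4).
  rewrite inE => al; exists a; apply: contraNN al => /(labelP zH)->.
  exact: eqxx.
have [|c [cq cP] ca] := @nbhd_list_colorable z a (D :\ z) zH.
  apply/subsetP=> x; rewrite 2!inE => /andP[xz xD]; rewrite inE (subsetP DH) //=.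
  by have := zdom x xD; rewrite /cadj eq_sym (negbTE xz) inE.
exists (fun x => if x == z then a else c x); split=> [x xD i|x y xD yD xy].
  have [->|xz] := eqVneq x z; first by apply: contraTneq => <-.
  by apply: cq; rewrite !inE xz.
have [xz|xz] := eqVneq x z; have [yz|yz] := eqVneq y z.
- by rewrite xz yz adj_irrefl in xy.
- by rewrite eq_sym; apply: ca; rewrite !inE yz.
- by apply: ca; rewrite !inE xz.
by apply: cP; rewrite // !inE ?xz ?yz.
Qed.

(** Windmills are split off one at a time; what remains is triangle-free, hence bipartite. *)
Lemma P4_free_list_colorable X :
  X \subset outer -> P4_free X -> list_colorable X.
Proof.
have [n] := ubnP #|X|; elim: n X => // n IHn X; rewrite ltnS => Xn XH pX.
case: (pickP [pred p : G * G * G |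
    [&& p.1.1 \in X, p.1.2 \in X & p.2 \in X] && triangle p.1.1 p.1.2 p.2]).
  case=> [[x y] t] /= /andP[xyt tri].
  have [z [zX _ zP]] := windmill dG pX xyt tri.
  pose D := [set u in X | cadj z u].
  have DX : D \subset X by apply/subsetP=> u; rewrite inE => /andP[].
  have zD : z \in D by rewrite inE zX /cadj eqxx.
  apply: (list_colorable_union DX).
  - move=> u v; rewrite !inE => /andP[uX zu] /andP[+ vX]; rewrite vX /=.
    by apply: contra => uv; apply: zP uv zu.
  - apply: (@dominated_list_colorable D z) => //; first exact: subset_trans DX XH.
    by move=> u; rewrite inE => /andP[].
  apply: IHn.
  - apply: leq_trans Xn; apply: proper_card; rewrite properE subsetDl.
    by apply/subsetPn; exists z => //; rewrite !inE zX /cadj eqxx.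
  - by apply: subset_trans XH; apply: subsetDl.
  by apply: P4_free_sub pX; apply: subsetDl.
move=> t0; apply: bipartite_list_colorable => // x y z xX yX zX.
by have := t0 (x, y, z); rewrite /= xX yX zX /= => ->.
Qed.

Lemma P4_unlabelled_pair i j a b c d : i != j -> p4 a b c d ->
  [|| adj (q i) a, adj (q i) b, adj (q i) c, adj (q i) d,
      adj (q j) a, adj (q j) b, adj (q j) c | adj (q j) d].
Proof. by move=> ij abcd; have := pG (q i) (q j) a b c d; rewrite q_adj ?abcd. Qed.

Hypothesis deg_ge : {in outer, forall x, k <= #|nbhd x|}.

(** Otherwise the neighbours of [x] would be pairwise adjacent by diamond-freeness, and [x] with its
    at least [k] neighbours would form too large a clique. *)
Lemma exists_private_nbr x z : x \in outer -> adj x z ->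
  exists2 u, adj x u & ~~ cadj z u.
Proof.
move=> xH xz; have [/existsP[u /andP[xu zu]]|] :=
    boolP [exists u, adj x u && ~~ cadj z u]; first by exists u.
rewrite negb_exists => /forallP H; have := deg_ge xH; rewrite leqNgt => /negP[].
have Nz u : adj x u -> cadj z u by move=> xu; have := H u; rewrite xu /= negbK.
have <- : #|x |: nbhd x| = #|nbhd x|.+1 by rewrite cardsU1 inE adj_irrefl.
apply: clique_le; apply/cliqueP=> u v; rewrite !inE.
case/predU1P=> [->|xu] /predU1P[->|xv] uv; rewrite ?eqxx // in uv *.
  by rewrite adj_sym.
case/predU1P: (Nz u xu) => zu; case/predU1P: (Nz v xv) => zv.
- by rewrite -zu -zv eqxx in uv.
- by rewrite -zu.
- by rewrite -zv adj_sym.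
by move: (dG x z u v); adj_split.
Qed.

Lemma exists_color2 (p : seq 'I_k) : (size p).+1 < k ->
  exists i j, [/\ i != j, i \notin p & j \notin p].
Proof.
move=> pk; have [|i] := @exists_color [set x in p].
  by rewrite cardsE (leq_ltn_trans (card_size p)) // ltnW.
rewrite inE => ip; have [|j] := @exists_color (i |: [set x in p]).
  rewrite cardsU1 inE ip add1n cardsE.
  by apply: leq_ltn_trans pk; rewrite ltnS card_size.
by rewrite !inE negb_or eq_sym => /andP[ij jp]; exists i, j.
Qed.

(** * Clique number at least 5 *)

Section FiveColors.

Hypothesis k_ge5 : 5 <= k.

(** The labels of the other three vertices miss two of the at least five colors, [i] and [j]. The
    edge between [q i] and [q j] must touch the P4, and can do so only at [x]. *)
Lemma P4_label a b c d x :
  [&& a \in outer, b \in outer, c \in outer & d \in outer] -> p4 a b c d ->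
  x \in [:: a; b; c; d] ->
  labelled x && all (fun y => (y == x) || (label y != label x)) [:: a; b; c; d].
Proof.
move=> abcdH abcd; set p := [:: a; b; c; d] => xp.
have pH y : y \in p -> y \in outer.
  move=> yp; have : [|| y == a, y == b, y == c | y == d] by move: yp; rewrite !inE.
  by case/and4P: abcdH => aH bH cH dH /or4P[]/eqP->.
pose s := [seq label y | y <- p & y != x].
have sz : (size s).+1 < k.
  rewrite size_map size_filter (leq_trans _ k_ge5) // !ltnS.
  have E : count_mem x p + count (fun y => y != x) p = 4 := count_predC _ _.
  by rewrite -ltnS -E -[X in X < _]add0n ltn_add2r -has_count has_pred1.
have [i [j [ij is_ js]]] := exists_color2 sz.
have ns l y : l \notin s -> y \in p -> adj (q l) y -> y = x.
  move=> ls yp ly; apply/eqP; apply: contraNT ls => yx; apply/mapP; exists y.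
    by rewrite mem_filter yx.
  exact: labelP (pH y yp) ly.
have [l ls lx] : exists2 l, l \notin s & adj (q l) x.
  have [ap bp cp dp] : [/\ a \in p, b \in p, c \in p & d \in p].
    by rewrite !inE !eqxx ?orbT.
  have := P4_unlabelled_pair ij abcd.
  case/or4P=> [h|h|h|/or4P[h|h|h|/orP[h|h]]].
  - by exists i; rewrite // -(ns i a).
  - by exists i; rewrite // -(ns i b).
  - by exists i; rewrite // -(ns i c).
  - by exists i; rewrite // -(ns i d).
  - by exists j; rewrite // -(ns j a).
  - by exists j; rewrite // -(ns j b).
  - by exists j; rewrite // -(ns j c).
  by exists j; rewrite // -(ns j d).
have lE := labelP (pH x xp) lx; rewrite /labelled -lE lx andTb.
apply/allP=> y yp; have [//|yx] := eqVneq y x.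
by apply: contraNneq ls => <-; apply/mapP; exists y; rewrite // mem_filter yx.
Qed.

Lemma not_P4_unlabelled a b c d x :
  [&& a \in outer, b \in outer, c \in outer & d \in outer] ->
  x \in [:: a; b; c; d] -> ~~ labelled x -> ~~ p4 a b c d.
Proof.
by move=> abcdH xp; apply: contra => /(P4_label abcdH)/(_ xp)/andP[].
Qed.

Lemma not_P4_same_label a b c d x y :
  [&& a \in outer, b \in outer, c \in outer & d \in outer] ->
  x \in [:: a; b; c; d] -> y \in [:: a; b; c; d] -> y != x ->
  label y = label x -> ~~ p4 a b c d.
Proof.
move=> abcdH xp yp yx lyx; apply/negP=> /(P4_label abcdH)/(_ xp)/andP[_].
by move/allP/(_ y yp); rewrite (negbTE yx) lyx eqxx.
Qed.

(** Let [i] differ from all four labels. If [uv] missed [xy], it would still touch the two P4s that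
    run from [q i] through [q (label x)] to [x], [y] and through [q (label y)] to [y], [x]. Then [u]
    and [v] would carry the labels of [x] and [y], one each. *)
Lemma labelled_edge_hit x y u v :
  [&& x \in outer, y \in outer, u \in outer & v \in outer] ->
  labelled x -> labelled y -> label x != label y -> adj x y ->
  ~~ labelled u || (label u == label v) -> adj u v ->
  [|| adj u x, adj u y, adj v x | adj v y].
Proof.
move=> /and4P[xH yH uH vH] lx ly lxy xy luv uv; apply: contraT.
rewrite !negb_or => /and4P[ux uy vx vy].
have hit s t : s \in outer -> t \in outer -> labelled s -> label s != label t ->
    labelled t -> adj s t -> ~~ adj u s -> ~~ adj u t -> ~~ adj v s ->
    ~~ adj v t -> adj (q (label s)) u || adj (q (label s)) v.
  move=> sH tH ls lst lt st us ut vs vt.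
  have [|i] := @exists_color [set j in [:: label s; label t; label u; label v]].
    by rewrite cardsE (leq_ltn_trans (card_size _)).
  rewrite !inE !negb_or => /and4P[is_ it iu iv].
  have nadj w : w \in outer -> i != label w -> ~~ adj (q i) w.
    by move=> wH; apply: contraNN => /(labelP wH)->.
  have := pG u v (q i) (q (label s)) s t.
  have is' := q_adj is_; have ist := nadj t tH it; have iss := nadj s sH is_.
  have iu' := nadj u uH iu; have iv' := nadj v vH iv.
  have st' : ~~ adj (q (label s)) t.
    by apply: contraNN lst => /(labelP tH)->.
  have ls' : adj (q (label s)) s := ls.
  by adj_split.
have := hit x y xH yH lx lxy ly xy ux uy vx vy.
have := hit y x yH xH ly _ lx _ uy ux vy vx; rewrite eq_sym adj_sym lxy xy.
move=> /(_ isT isT) h1 h2.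
have lab s t : t \in outer -> adj (q (label s)) t -> labelled t /\ label t = label s.
  by move=> tH st; rewrite /labelled -(labelP tH st).
case/orP: h1 => /lab[] // l1 e1; case/orP: h2 => /lab[] // l2 e2.
- by rewrite -e1 -e2 eqxx in lxy.
- by move: luv; rewrite l1 e1 e2 eq_sym (negbTE lxy).
- by move: luv; rewrite l2 e1 e2 (negbTE lxy).
by rewrite -e1 -e2 eqxx in lxy.
Qed.

Section GivenP4.

Variables (a b c d : G).
Hypothesis abcdH : [&& a \in outer, b \in outer, c \in outer & d \in outer].
Hypothesis abcd : p4 a b c d.

Let labels_abcd :
  [/\ [&& labelled a, labelled b, labelled c & labelled d],
      [&& label a != label b, label b != label c & label c != label d] &
      forall x, x \in [:: a; b; c; d] -> labelled x].
Proof.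
have P x := P4_label (x := x) abcdH abcd.
have lP x : x \in [:: a; b; c; d] -> labelled x by case/P/andP.
have [la lb lc ld] : [/\ labelled a, labelled b, labelled c & labelled d].
  by split; apply: lP; rewrite !inE eqxx ?orbT.
have [|_ /allP Pb] := andP (P b _); first by rewrite !inE eqxx orbT.
have [|_ /allP Pc] := andP (P c _); first by rewrite !inE eqxx !orbT.
have /and5P[ab bc cd _ _] := abcd.
have ha := Pb a; have hc := Pb c; have hd := Pc d.
rewrite !inE !eqxx ?orbT in ha hc hd.
split=> //; first by rewrite la lb lc ld.
move: (ha isT) (hc isT) (hd isT); rewrite (negbTE (adj_neq ab)).
rewrite (eq_sym c b) (negbTE (adj_neq bc)) (eq_sym d c) (negbTE (adj_neq cd)) /=.
by rewrite (eq_sym (label c)) (eq_sym (label d)) => -> -> ->.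
Qed.

(** An unlabelled [r] lies on no P4, so it sees neither [a] nor [d], and both or none of [b], [c].
    If both, a neighbour of [r] that is private with respect to [b] yields a P4 through [r]. If
    none, a neighbour [s] of [r] must touch all three edges of the P4, which yields a P4 through [r]
    or a diamond. *)
Lemma P4_all_labelled r : r \in outer -> labelled r.
Proof.
move=> rH; apply: contraT => lr.
have [/and4P[la lb lc ld] /and3P[lab lbc lcd] lp] := labels_abcd.
have /and4P[aH bH cH dH] := abcdH.
have rn x : x \in [:: a; b; c; d] -> r != x.
  by move=> /lp lx; apply: contraNneq lr => ->.
have [ra rb rc rd] : [/\ r != a, r != b, r != c & r != d].
  by split; apply: rn; rewrite !inE eqxx ?orbT.
have n1 x y z : x \in outer -> y \in outer -> z \in outer -> ~~ p4 r x y z.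
  move=> xH yH zH; apply: (@not_P4_unlabelled _ _ _ _ r) => //; last by rewrite inE eqxx.
  by rewrite rH xH yH zH.
have n2 x y z : x \in outer -> y \in outer -> z \in outer -> ~~ p4 x r y z.
  move=> xH yH zH; apply: (@not_P4_unlabelled _ _ _ _ r) => //; last by rewrite !inE eqxx orbT.
  by rewrite rH xH yH zH.
have /and5P[ab bc cd ac /andP[ad bd]] := abcd.
have nac : a != c by apply: contraNneq ad => ->.
have nbd : b != d by apply: contraNneq ad => <-.
have pat : ~~ adj r a && ~~ adj r d && (adj r b == adj r c).
  move: (n1 a b c aH bH cH) (n1 b c d bH cH dH) (n1 c b a cH bH aH)
    (n1 d c b dH cH bH) (n2 a c d aH cH dH) (n2 d b a dH bH aH)
    (n2 a d c aH dH cH) (n2 d a b dH aH bH) (dG r b a c) (dG r c b d).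
  by adj_split.
have sH s : adj r s -> s \in outer.
  move=> rs; rewrite inE; apply/negP=> /codomP[i si].
  by have := labelledPn i lr; rewrite -si adj_sym rs.
have hits s : adj r s -> [&& [|| adj r a, adj r b, adj s a | adj s b],
    [|| adj r b, adj r c, adj s b | adj s c] & [|| adj r c, adj r d, adj s c | adj s d]].
  move=> rs; have sH' := sH s rs.
  by apply/and3P; split; apply: labelled_edge_hit; rewrite // ?rH ?sH' ?lr ?aH ?bH ?cH ?dH.
case/andP: pat => /andP[ra' rd'] /eqP rbc.
have [rb'|rb'] := boolP (adj r b).
  have rc' : adj r c by rewrite -rbc.
  have [s rs bs] := exists_private_nbr rH rb'.
  move: bs; rewrite negb_or => /andP[bs nbs].
  have sH' := sH s rs.
  have sc : s != c by apply: contraNneq nbs => ->.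
  move: (dG r c s b) (n2 s b a sH' bH aH) (n2 s c d sH' cH dH) (n2 c s a cH sH' aH).
  by adj_split.
have rc' : ~~ adj r c by rewrite -rbc.
have [s rs] : exists s, adj r s.
  have : 0 < #|nbhd r| by rewrite (leq_trans _ (deg_ge rH)) // (leq_trans _ k_ge4).
  by case/card_gt0P=> s; rewrite inE; exists s.
have sH' := sH s rs.
have [sa sb sc sd] : [/\ s != a, s != b, s != c & s != d].
  by split; apply: contraTneq rs => ->.
move: (hits s rs) (n1 s b a sH' bH aH) (n1 s c d sH' cH dH) (n1 s b c sH' bH cH) (n1 s c b sH' cH bH) (dG s b a c).
by adj_split.
Qed.

End GivenP4.

(** The common neighbours [x] and [q (label u)] of [u] and [v] would be adjacent, giving [x] the
    same label. *)
Lemma common_nbr_label u v x : labelled u -> labelled v ->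
  label u = label v -> adj u v -> x \in outer -> label x != label u ->
  ~~ (adj u x && adj v x).
Proof.
move=> lu lv luv uv xH xu; apply/negP=> /andP[ux vx].
have qx := outer_neq (label u) xH.
have nqx : ~~ adj (q (label u)) x by apply: contraNN xu => /(labelP xH)->.
have qu : adj (q (label u)) u := lu.
have qv : adj (q (label u)) v by move: lv; rewrite /labelled -luv.
by move: (dG u v x (q (label u))); adj_split.
Qed.

Lemma P4_labels_uniq a b c d :
  [&& a \in outer, b \in outer, c \in outer & d \in outer] -> p4 a b c d ->
  uniq [:: label a; label b; label c; label d].
Proof.
move=> H4 abcd; rewrite -[X in uniq X]/(map label [:: a; b; c; d]).
rewrite map_inj_in_uniq.
  have /and5P[ab bc cd ac /andP[ad bd]] := abcd.
  have nac : a != c by apply: contraNneq ad => ->.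
  have nbd : b != d by apply: contraNneq ad => <-.
  have nad : a != d by apply: contraNneq bd => <-; rewrite adj_sym.
  by rewrite /= !inE !negb_or nac nbd nad !adj_neq.
move=> x y xp yp lxy; apply/eqP; have /andP[_ /allP/(_ x xp)] := P4_label H4 abcd yp.
by rewrite lxy eqxx orbF.
Qed.

(** No P4 contains both [u] and [v], and [v] is not adjacent to [b] by [common_nbr_label]. This
    forces [v] to be adjacent to [c], then to [d], and then [b u v d] is a P4. *)
Lemma same_label_P4_end b c d u v :
  [&& u \in outer, b \in outer, c \in outer & d \in outer] -> p4 u b c d ->
  v \in outer -> adj u v -> label u = label v -> False.
Proof.
move=> H4 ubcd vH uv luv; have lP := P4_all_labelled H4 ubcd.
have /and4P[uH bH cH dH] := H4; have /and5P[ub bc cd uc /andP[ud bd]] := ubcd.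
have nvu : v != u by rewrite eq_sym adj_neq.
have := P4_labels_uniq H4 ubcd; rewrite /= !inE !negb_or !(eq_sym (label u)).
case/and4P=> /and3P[lb lc ld] _ _ _.
have nc x : x \in outer -> label x != label u -> ~~ (adj u x && adj v x).
  by move=> xH; apply: common_nbr_label => //; apply: lP.
have np x y : x \in outer -> y \in outer -> [/\ ~~ p4 v u x y, ~~ p4 u v x y & ~~ p4 x u v y].
  move=> xH yH; split; (apply: (@not_P4_same_label _ _ _ _ u v) => //;
    [by rewrite ?uH ?vH ?xH ?yH | by rewrite !inE eqxx ?orbT | by rewrite !inE eqxx ?orbT]).
have [n1 _ _] := np b c bH cH; have [_ n2 _] := np c d cH dH; have [_ _ n3] := np b d bH dH.
move: (nc b bH lb) (nc c cH lc) (nc d dH ld) n1 n2 n3.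
by adj_split.
Qed.

Lemma same_label_P4_mid a c d u v :
  [&& a \in outer, u \in outer, c \in outer & d \in outer] -> p4 a u c d ->
  v \in outer -> adj u v -> label u = label v -> False.
Proof.
move=> H4 aucd vH uv luv; have lP := P4_all_labelled H4 aucd.
have /and4P[aH uH cH dH] := H4; have /and5P[au uc cd ac /andP[ad ud]] := aucd.
have nvu : v != u by rewrite eq_sym adj_neq.
have := P4_labels_uniq H4 aucd; rewrite /= !inE !negb_or !(eq_sym (label u)).
case/and4P=> /and3P[la _ _] /andP[lc ld] _ _.
have nc x : x \in outer -> label x != label u -> ~~ (adj u x && adj v x).
  by move=> xH; apply: common_nbr_label => //; apply: lP.
have np x y : x \in outer -> y \in outer -> [/\ ~~ p4 v u x y, ~~ p4 u v x y & ~~ p4 x u v y].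
  move=> xH yH; split; (apply: (@not_P4_same_label _ _ _ _ u v) => //;
    [by rewrite ?uH ?vH ?xH ?yH | by rewrite !inE eqxx ?orbT | by rewrite !inE eqxx ?orbT]).
have [n1 _ _] := np c d cH dH; have [_ _ n3] := np a d aH dH.
move: (nc a aH la) (nc c cH lc) (nc d dH ld) n1 n3.
by adj_split.
Qed.

Lemma p4_rev (a b c d : G) : p4 a b c d = p4 d c b a.
Proof. by adj_split. Qed.

(** By [same_label_P4_end] and [same_label_P4_mid], adjacent [u] and [v] avoid the P4, and no vertex
    of it is adjacent to both. The edge [uv] must touch [ab], [bc] and [cd]; every way of doing so
    yields a P4 containing [u] and [v], or a diamond. *)
Lemma same_label_not_adj a b c d u v :
  [&& a \in outer, b \in outer, c \in outer & d \in outer] -> p4 a b c d ->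
  u \in outer -> v \in outer -> label u = label v -> ~~ adj u v.
Proof.
move=> H4 abcd uH vH luv; apply/negP=> uv; have lP := P4_all_labelled H4 abcd.
have notin x y : x \in outer -> y \in outer -> label x = label y -> adj x y ->
    [&& x != a, x != b, x != c & x != d].
  move=> xH yH lxy xy; rewrite -!negb_or; apply/negP.
  have H4' : [&& d \in outer, c \in outer, b \in outer & a \in outer].
    by case/and4P: H4 => -> -> -> ->.
  have dcba : p4 d c b a by rewrite -p4_rev.
  case/or4P=> /eqP xE; rewrite -xE in H4 H4' abcd dcba.
  - exact: same_label_P4_end H4 abcd yH xy lxy.
  - exact: same_label_P4_mid H4 abcd yH xy lxy.
  - exact: same_label_P4_mid H4' dcba yH xy lxy.
  exact: same_label_P4_end H4' dcba yH xy lxy.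
have nuv : v != u by rewrite eq_sym adj_neq.
have vu : adj v u by rewrite adj_sym.
have /and4P[ua ub uc ud] := notin u v uH vH luv uv.
have /and4P[va vb vc vd] := notin v u vH uH (esym luv) vu.
have nc x : x \in outer -> u != x -> v != x -> [|| x == a, x == b, x == c | x == d] ->
    ~~ (adj u x && adj v x).
  move=> xH ux vx xp; have [lxu|] := eqVneq (label x) (label u); last first.
    by apply: common_nbr_label => //; apply: lP.
  apply/negP=> /andP[ux' _]; have xu : adj x u by rewrite adj_sym.
  have := notin x u xH uH lxu xu; rewrite -!negb_or => /negP[].
  by rewrite xp.
have np x y : x \in outer -> y \in outer ->
    [/\ ~~ p4 v u x y, ~~ p4 u v x y, ~~ p4 x u v y & ~~ p4 x v u y].
  move=> xH yH; split; (apply: (@not_P4_same_label _ _ _ _ u v) => //;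
    [by rewrite ?uH ?vH ?xH ?yH | by rewrite !inE eqxx ?orbT | by rewrite !inE eqxx ?orbT]).
have /and4P[aH bH cH dH] := H4; have /and5P[ab bc cd ac /andP[ad bd]] := abcd.
have hit x y : x \in outer -> y \in outer -> label x != label y -> adj x y ->
    [|| adj u x, adj u y, adj v x | adj v y].
  move=> xH yH lxy xy; apply: labelled_edge_hit; rewrite ?uH ?vH ?xH ?yH ?lP //.
  by rewrite luv eqxx orbT.
have := P4_labels_uniq H4 abcd; rewrite /= !inE !negb_or.
case/and4P=> /and3P[lab _ _] /andP[lbc _] lcd _.
have nac : a != c by apply: contraNneq ad => ->.
have nbd : b != d by apply: contraNneq ad => <-.
move: (hit b c bH cH lbc bc) (hit a b aH bH lab ab) (hit c d cH dH lcd cd).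
move: (nc a aH ua va) (nc b bH ub vb) (nc c cH uc vc) (nc d dH ud vd).
rewrite !eqxx !orbT /= => /(_ isT) na /(_ isT) nb /(_ isT) nnc /(_ isT) nd.
have [ab1 ab2 ac3 ac4] := np a b aH bH; have [ba1 ba2 _ _] := np b a bH aH.
have [bc1 bc2 _ _] := np b c bH cH; have [cb1 cb2 _ _] := np c b cH bH.
have [cd1 cd2 _ _] := np c d cH dH; have [dc1 dc2 _ _] := np d c dH cH.
have [_ _ x1 x2] := np a c aH cH; have [_ _ x3 x4] := np b d bH dH.
have [_ _ x5 x6] := np a d aH dH.
move: (dG u b a c) (dG u c b d) (dG v b a c) (dG v c b d).
move: ab1 ab2 ba1 ba2 bc1 bc2 cb1 cb2 cd1 cd2 dc1 dc2 x1 x2 x3 x4 x5 x6 na nb nnc nd.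
by adj_split.
Qed.

Lemma five_colors_list_colorable : list_colorable outer.
Proof.
have [p0|] := boolP [forall a in outer, forall b in outer, forall c in outer,
    forall d in outer, ~~ p4 a b c d].
  apply: P4_free_list_colorable => // a b c d aH bH cH dH.
  by move/forall_inP/(_ a aH)/forall_inP/(_ b bH)/forall_inP/(_ c cH)/forall_inP: p0; apply.
rewrite negb_forall_in => /exists_inP[a aH]; rewrite negb_forall_in => /exists_inP[b bH].
rewrite negb_forall_in => /exists_inP[c cH]; rewrite negb_forall_in => /exists_inP[d dH].
rewrite negbK => abcd.
have H4 : [&& a \in outer, b \in outer, c \in outer & d \in outer].
  by rewrite aH bH cH dH.
exists (fun x => ordS (label x)); split=> [x xH i /(labelP xH)-> | x y xH yH xy].
  rewrite -(inj_eq val_inj) /=; have := ltn_ord (label x).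
  rewrite leq_eqVlt => /predU1P[lk|lk]; last by rewrite modn_small // gtn_eqF.
  (* The last label wraps around to 0, which would equal it only for [k = 1]. *)
  rewrite lk modnn; apply: contraTneq k_ge5 => l0.
  by rewrite -lk -l0.
rewrite (inj_eq (@ordS_inj k)); apply: contraTneq xy.
exact: same_label_not_adj H4 abcd xH yH.
Qed.

End FiveColors.

(** * Clique number 4 *)

Section FourColors.

Hypothesis k_le4 : k <= 4.

Lemma no_K5 (a b c d e : G) : ~~ pairwise (@adj G) [:: a; b; c; d; e].
Proof.
by apply/negP=> /pairwise_adj_le /= k5; have := leq_trans k5 k_le4.
Qed.

Lemma label_cover (i j l m n : 'I_k) : uniq [:: i; j; l; m] ->
  n \in [:: i; j; l; m].
Proof.
move=> U; apply: contraT => nN; have : uniq [:: n, i, j, l & [:: m]] by rewrite /= nN.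
by move/card_uniqP=> c5; have := leq_trans (max_card (mem [:: n, i, j, l & [:: m]]));
  rewrite c5 card_ord => /(_ _ k_le4).
Qed.

(* The vertices of the clique other than q i, q j supply an edge far from this
   set, which is why it is P4-free. *)
Definition sector i j : {set G} :=
  [set x in outer | labelled x ==> (label x \in [:: i; j])].

Lemma sectorC i j : sector i j = sector j i.
Proof. by apply/setP=> x; rewrite !inE orbC. Qed.

Lemma sector_outer i j x : x \in sector i j -> x \in outer.
Proof. by rewrite inE => /andP[]. Qed.

Lemma sector_label i j l x :
  x \in sector i j -> l != i -> l != j -> ~~ adj (q l) x.
Proof.
rewrite inE => /andP[xH xl] li lj; apply: contraL xl => lx.
have E := labelP xH lx; rewrite negb_imply /labelled -E lx !inE negb_or.
by rewrite li lj.
Qed.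

Lemma sector_unlabelled i j x : x \in outer -> ~~ labelled x -> x \in sector i j.
Proof. by move=> xH /negbTE xl; rewrite inE xH xl. Qed.

Lemma sector_l i j x : x \in outer -> adj (q i) x -> x \in sector i j.
Proof. by move=> xH ix; rewrite inE xH (labelP xH ix) !inE eqxx implybT. Qed.

Lemma sector_r i j x : x \in outer -> adj (q j) x -> x \in sector i j.
Proof. by rewrite sectorC; apply: sector_l. Qed.

Lemma sector_P4_free i j : i != j -> P4_free (sector i j).
Proof.
move=> ij; have [|l [m [lm]]] := @exists_color2 [:: i; j]; first exact: k_ge4.
rewrite !inE !negb_or => /andP[li lj] /andP[mi mj] a b c d aS bS cS dS.
apply/negP=> /(P4_unlabelled_pair lm).
have N x : x \in sector i j -> ~~ adj (q l) x /\ ~~ adj (q m) x.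
  by move=> xS; split; apply: (sector_label xS).
have [/negbTE-> /negbTE->] := N a aS; have [/negbTE-> /negbTE->] := N b bS.
by have [/negbTE-> /negbTE->] := N c cS; have [/negbTE-> /negbTE->] := N d dS.
Qed.

(** With a third color [l], there are P4s from [q l] through [q i] to [x], [y] and through [q j] to
    [y], [x]. An edge [uv] that misses [x] and [y] must be seen by both [q i] and [q j]. *)
Lemma sector_edge_hit i j x y u v : i != j -> x \in outer -> y \in outer ->
  adj (q i) x -> adj (q j) y -> adj x y ->
  u \in sector i j -> v \in sector i j -> adj u v ->
  [|| adj u x, adj u y, adj v x | adj v y] ||
  (adj (q i) u && adj (q j) v || adj (q j) u && adj (q i) v).
Proof.
move=> ij xH yH ix jy xy uS vS uv.
have [|l] := @exists_color [set i; j]; first by rewrite cards2 ij (leq_trans _ k_ge4).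
rewrite !inE negb_or => /andP[li lj].
have n1 w : w \in outer -> adj (q i) w -> ~~ adj (q j) w /\ ~~ adj (q l) w.
  move=> wH iw; split; apply/negP=> h; first by rewrite (label_unique wH iw h) eqxx in ij.
  by rewrite (label_unique wH iw h) eqxx in li.
have n2 w : w \in outer -> adj (q j) w -> ~~ adj (q i) w /\ ~~ adj (q l) w.
  move=> wH jw; split; apply/negP=> h; first by rewrite (label_unique wH jw h) eqxx in ij.
  by rewrite (label_unique wH jw h) eqxx in lj.
have [jx lx] := n1 x xH ix; have [iy ly] := n2 y yH jy.
have lu := sector_label uS li lj; have lv := sector_label vS li lj.
have uij := n1 u (sector_outer uS); have vij := n1 v (sector_outer vS).
have nu : ~~ (adj (q i) u && adj (q j) u).
  by apply/negP=> /andP[/uij[/negP]].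
have nv : ~~ (adj (q i) v && adj (q j) v).
  by apply/negP=> /andP[/vij[/negP]].
have lij := q_adj li; have ljj := q_adj lj.
move: (pG u v (q l) (q i) x y) (pG u v (q l) (q j) y x) nu nv.
by clear - xy lij ljj ix jx lx iy ly jy lu lv uv; adj_split.
Qed.

(** Otherwise every edge of the triangle would join the labels [i] and [j], but a triangle is not
    bipartite. *)
Lemma sector_triangle_hit i j x y t1 t2 t3 : i != j -> x \in outer -> y \in outer ->
  adj (q i) x -> adj (q j) y -> adj x y ->
  [&& t1 \in sector i j, t2 \in sector i j & t3 \in sector i j] ->
  triangle t1 t2 t3 ->
  exists2 t, t \in [:: t1; t2; t3] & adj t x || adj t y.
Proof.
move=> ij xH yH ix jy xy /and3P[S1 S2 S3] /and3P[a12 a23 a13].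
have hit := sector_edge_hit ij xH yH ix jy xy.
have nn t : t \in sector i j -> ~~ (adj (q i) t && adj (q j) t).
  move=> /sector_outer tH; apply/negP=> /andP[it jt].
  by rewrite (label_unique tH it jt) eqxx in ij.
have : [|| adj t1 x || adj t1 y, adj t2 x || adj t2 y | adj t3 x || adj t3 y].
  move: (hit t1 t2 S1 S2 a12) (hit t2 t3 S2 S3 a23) (hit t1 t3 S1 S3 a13).
  move: (nn t1 S1) (nn t2 S2) (nn t3 S3); clear; adj_split.
case/or3P=> h; [exists t1 | exists t2 | exists t3] => //;
  by rewrite !inE eqxx ?orbT.
Qed.

Definition sector_center i j z : Prop := z \in sector i j /\
  {in sector i j &, forall u v, adj u v -> cadj z u && cadj z v}.

(** An edge joining the labels [i] and [j], such as [xy], reaches the triangle by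
    [sector_triangle_hit], hence lies in its windmill. By [sector_edge_hit], any other edge reaches
    [xy]. *)
Lemma sector_windmill i j x y t1 t2 t3 : i != j -> x \in outer -> y \in outer ->
  adj (q i) x -> adj (q j) y -> adj x y ->
  [&& t1 \in sector i j, t2 \in sector i j & t3 \in sector i j] ->
  triangle t1 t2 t3 ->
  exists2 z, sector_center i j z & [&& cadj z t1, cadj z t2 & cadj z t3].
Proof.
move=> ij xH yH ix jy xy TS tri.
have [z [zS zT zP]] := windmill dG (sector_P4_free ij) TS tri.
exists z => //; split=> //.
have zt t : t \in [:: t1; t2; t3] -> t \in sector i j /\ cadj z t.
  case/and3P: TS => S1 S2 S3; case/and3P: zT => c1 c2 c3.
  have E : (t \in [:: t1; t2; t3]) = [|| t == t1, t == t2 | t == t3] by rewrite !inE.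
  by rewrite E => /or3P[]/eqP->.
have closed u v : u \in sector i j -> v \in sector i j -> adj u v -> cadj z u = cadj z v.
  by move=> uS vS uv; apply/idP/idP; apply: zP; rewrite // adj_sym.
have typed u v : u \in sector i j -> v \in sector i j -> adj u v ->
    adj (q i) u -> adj (q j) v -> cadj z u && cadj z v.
  move=> uS vS uv iu jv; have E := closed u v uS vS uv; rewrite -E andbb.
  have [t /zt[tS ct]] := sector_triangle_hit ij (sector_outer uS) (sector_outer vS)
    iu jv uv TS tri.
  by case/orP=> [tu|tv]; [rewrite -(closed t u) | rewrite E -(closed t v)].
have xS : x \in sector i j by apply: sector_l.
have yS : y \in sector i j by apply: sector_r.
have /andP[zx zy] := typed x y xS yS xy ix jy.
move=> u v uS vS uv; have := sector_edge_hit ij xH yH ix jy xy uS vS uv.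
have E := closed u v uS vS uv.
case/orP=> [|/orP[/andP[iu jv]|/andP[ju iv]]]; last 2 first.
- exact: typed.
- by rewrite andbC; apply: typed; rewrite // adj_sym.
rewrite -E andbb; case/or4P=> h.
- by rewrite (closed u x).
- by rewrite (closed u y).
- by rewrite E (closed v x).
by rewrite E (closed v y).
Qed.

Lemma triangle_same_label i x y z : z \in outer -> triangle x y z ->
  adj (q i) x -> adj (q i) y -> adj (q i) z.
Proof.
move=> zH /and3P[xy yz xz] ix iy; have zq := outer_neq i zH.
by move: (dG x y z (q i)); adj_split.
Qed.

Lemma common_sector i u v : u \in outer -> v \in outer ->
  [|| ~~ labelled u, label u == i | label u == label v] ->
  exists2 j, i != j & (u \in sector i j) && (v \in sector i j).
Proof.
move=> uH vH h; have [lvi|lvi] := eqVneq (label v) i.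
  have [|j] := @exists_color [set i]; first by rewrite cards1 (leq_trans _ k_ge4).
  rewrite inE eq_sym => ij; exists j => //; rewrite !inE in uH vH *.
  rewrite uH vH lvi eqxx implybT andbT /=; rewrite lvi orbb in h.
  by case/orP: h => [/negbTE->|->] //; rewrite implybT.
exists (label v); first by rewrite eq_sym.
rewrite !inE in uH vH *; rewrite uH vH eqxx orbT implybT andbT /=.
by case/or3P: h => [/negbTE->|->|->]; rewrite ?orbT ?implybT.
Qed.

(** * A triangle whose vertices all have the label [a] *)

Section MonochromaticTriangle.

Variables (a : 'I_k).

Definition mono t1 t2 t3 : bool :=
  [&& triangle t1 t2 t3, [&& t1 \in outer, t2 \in outer & t3 \in outer] &
      [&& adj (q a) t1, adj (q a) t2 & adj (q a) t3]].

Lemma mono_rot t1 t2 t3 : mono t1 t2 t3 = mono t2 t3 t1.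
Proof.
rewrite /mono triangle_rot.
by case: (t1 \in outer) (t2 \in outer) (t3 \in outer) (adj (q a) t1) (adj (q a) t2)
  (adj (q a) t3) => [] [] [] [] [] []; rewrite ?andbF.
Qed.

(** The vertices [q a], [t1], [t2], [t3] form a K4, and [u] sees two of them. *)
Lemma mono_nbr t1 t2 t3 u : mono t1 t2 t3 -> u \in outer -> adj t1 u ->
  adj (q a) u || adj t2 u -> cadj t2 u && cadj t3 u.
Proof.
case/and3P=> /and3P[t12 t23 t13] _ /and3P[a1 a2 a3] uH t1u h.
have uq := outer_neq a uH.
move: h (dG t1 t2 t3 u) (dG t1 (q a) t2 u) (dG t1 (q a) t3 u) (dG t1 t2 (q a) u).
by adj_split.
Qed.

Lemma mono_dominated t1 t2 t3 u : mono t1 t2 t3 -> u \in outer ->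
  cadj u t1 -> cadj u t2 -> cadj u t3 -> [|| u == t1, u == t2 | u == t3].
Proof.
case/and3P=> /and3P[t12 t23 t13] _ /and3P[a1 a2 a3] uH.
have uq := outer_neq a uH.
move: (no_K5 (q a) t1 t2 t3 u) (dG t1 t2 u (q a)); rewrite /=.
by adj_split.
Qed.

Lemma mono_private_nbr t1 t2 t3 : mono t1 t2 t3 ->
  exists2 v, v \in outer & adj t1 v && (~~ cadj t2 v && ~~ cadj t3 v).
Proof.
move=> M; have /and3P[/and3P[t12 t23 t13] /and3P[t1H t2H t3H] /and3P[a1 a2 a3]] := M.
have [v t1v t2v] := exists_private_nbr t1H t12.
have vH : v \in outer.
  rewrite inE; apply/negP=> /codomP[b vb].
  have ba : b = a by apply: label_unique t1H _ a1; rewrite -vb adj_sym.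
  by move: t2v; rewrite vb ba /cadj adj_sym a2 orbT.
exists v; rewrite // t1v t2v /=; apply: contra t2v => t3v.
have M' : mono t1 t3 t2.
  by rewrite /mono triangle_swap /triangle t12 t23 t13 t1H t2H t3H a1 a2 a3.
case/predU1P: t3v => [<-|t3v]; first by rewrite /cadj t23 orbT.
by have /andP[] := mono_nbr M' vH t1v (introT orP (or_intror t3v)).
Qed.

(** Otherwise [common_sector] puts [v], [w] and the triangle into one P4-free sector, against
    [attach_unique]. *)
Lemma mono_private_label t1 t2 t3 v w : mono t1 t2 t3 ->
  v \in outer -> adj t1 v -> ~~ cadj t2 v ->
  w \in outer -> adj t2 w -> ~~ cadj t1 w ->
  [&& labelled v, label v != a & label v != label w].
Proof.
move=> M vH t1v t2v wH t2w t1w; apply: contraT => h.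
have [|j aj /andP[vS wS]] := @common_sector a v w vH wH.
  by move: h; rewrite !negb_and !negbK.
have /and3P[tri /and3P[t1H t2H t3H] /and3P[a1 a2 a3]] := M.
have tS t : t \in outer -> adj (q a) t -> t \in sector a j by apply: sector_l.
move: t2v t1w; rewrite !negb_or => /andP[t2v nt2v] /andP[t1w nt1w].
case: (@attach_unique G dG (sector a j) t1 t2 t3 v w) => //.
- exact: sector_P4_free.
- by rewrite (tS t1) // (tS t2) // (tS t3) // vS wS.
- by rewrite eq_sym.
- by rewrite eq_sym.
- by rewrite adj_sym.
- by rewrite adj_sym.
- by rewrite adj_sym.
by rewrite adj_sym.
Qed.

(** The sector contains the triangle and the edge from [t1] to [v], so it has a center. By
    [mono_dominated] this is one of the [t]s, and only [t1] is adjacent to [v]. *)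
Lemma mono_center t1 t2 t3 v : mono t1 t2 t3 -> v \in outer ->
  adj t1 v -> ~~ cadj t2 v -> ~~ cadj t3 v -> labelled v -> label v != a ->
  {in sector a (label v) &, forall u w, adj u w -> cadj t1 u && cadj t1 w}.
Proof.
move=> M vH t1v t2v t3v lv lva.
have /and3P[tri /and3P[t1H t2H t3H] /and3P[a1 a2 a3]] := M.
have tS t : t \in outer -> adj (q a) t -> t \in sector a (label v) by apply: sector_l.
have vS : v \in sector a (label v) by apply: sector_r.
have alv : a != label v by rewrite eq_sym.
have TS : [&& t1 \in sector a (label v), t2 \in sector a (label v)
           & t3 \in sector a (label v)] by rewrite !tS.
have [z [zS zP] /and3P[z1 z2 z3]] :=
  sector_windmill alv t1H vH a1 lv t1v TS tri.
have zv : cadj z v by case/andP: (zP t1 v (tS t1 t1H a1) vS t1v).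
have := mono_dominated M (sector_outer zS) z1 z2 z3.
case/or3P=> /eqP zE; rewrite zE in zP zv; first exact: zP.
  by rewrite zv in t2v.
by rewrite zv in t3v.
Qed.

(** Private neighbours of [t1], [t2], [t3] show the three labels [b1], [b2], [b3] other than [a],
    and the sector of [a] and [b1] has center [t1], and so on cyclically. In the triangle, a vertex
    of label [b1] can only see [t1]; so [t1] takes [b1], and the vertices of label [b1] take
    [b2]. *)
Lemma mono_list_colorable t1 t2 t3 : mono t1 t2 t3 -> list_colorable outer.
Proof.
move=> M1; have M2 : mono t2 t3 t1 by rewrite -mono_rot.
have M3 : mono t3 t1 t2 by rewrite mono_rot.
have [v1 v1H /andP[t1v1 /andP[t2v1 t3v1]]] := mono_private_nbr M1.
have [v2 v2H /andP[t2v2 /andP[t3v2 t1v2]]] := mono_private_nbr M2.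
have [v3 v3H /andP[t3v3 /andP[t1v3 t2v3]]] := mono_private_nbr M3.
have /and3P[l1 b1a b12] := mono_private_label M1 v1H t1v1 t2v1 v2H t2v2 t1v2.
have /and3P[l2 b2a b23] := mono_private_label M2 v2H t2v2 t3v2 v3H t3v3 t2v3.
have /and3P[l3 b3a b31] := mono_private_label M3 v3H t3v3 t1v3 v1H t1v1 t3v1.
have P1 := mono_center M1 v1H t1v1 t2v1 t3v1 l1 b1a.
have P2 := mono_center M2 v2H t2v2 t3v2 t1v2 l2 b2a.
have P3 := mono_center M3 v3H t3v3 t1v3 t2v3 l3 b3a.
move: (label v1) (label v2) (label v3) b1a b2a b3a b12 b23 b31 P1 P2 P3.
move=> b1 b2 b3 b1a b2a b3a b12 b23 b31 P1 P2 P3.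
have /and3P[/and3P[t12 t23 t13] /and3P[t1H t2H t3H] /and3P[a1 a2 a3]] := M1.
have lab1 : a = label t1 := labelP t1H a1.
have lab2 : a = label t2 := labelP t2H a2.
have lab3 : a = label t3 := labelP t3H a3.
pose T := [:: t1; t2; t3]; pose B := [:: b1; b2; b3].
have TE t : (t \in T) = [|| t == t1, t == t2 | t == t3] by rewrite !inE.
have BE b : (b \in B) = [|| b == b1, b == b2 | b == b3] by rewrite !inE.
pose apex b := if b == b1 then t1 else if b == b2 then t2 else t3.
pose next b := if b == b1 then b2 else if b == b2 then b3 else b1.
pose c x := if x == t1 then b1 else if x == t2 then b2 else if x == t3 then b3
  else next (label x).
have cover n : n != a -> n \in B.
  move=> na; have : n \in [:: a; b1; b2; b3].
    apply: label_cover; rewrite /= !inE !negb_or b12 b23 !(eq_sym a) b1a b2a b3a.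
    by rewrite (eq_sym b1 b3) b31.
  by rewrite inE (negbTE na).
have Ba b : b \in B -> b != a by rewrite BE => /or3P[]/eqP->.
have Tprop t : t \in T -> [/\ t \in outer, adj (q a) t & label t = a].
  by rewrite TE => /or3P[]/eqP->.
have apexT b : apex b \in T.
  by rewrite TE /apex; do ![case: ifP => _]; rewrite eqxx ?orbT.
have [n21 n31 n32] : [/\ (t2 == t1) = false, (t3 == t1) = false & (t3 == t2) = false].
  by split; apply/negbTE; rewrite eq_sym adj_neq.
have [m21 m31 m32] : [/\ (b2 == b1) = false, (b3 == b1) = false & (b3 == b2) = false].
  by split; apply/negbTE; rewrite // eq_sym.
have cT t : t \in T -> c t \in B /\ apex (c t) = t.
  by rewrite TE BE /c /apex => /or3P[]/eqP->;
    rewrite ?eqxx ?n21 ?n31 ?n32 ?eqxx ?m21 ?m31 ?m32 ?orbT.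
have nextP b : next b != b.
  rewrite /next; have [->|n1] := eqVneq b b1; first by rewrite m21.
  by have [->|n2] := eqVneq b b2; rewrite ?m32 // eq_sym.
have next_inj : {in B &, injective next}.
  move=> b b'; rewrite !BE /next => /or3P[]/eqP-> /or3P[]/eqP->;
  rewrite ?eqxx ?m21 ?m31 ?m32 // => /eqP; by rewrite ?m21 ?m31 ?m32 1?eq_sym ?m21 ?m31 ?m32.
have center b : b \in B ->
    {in sector a b &, forall u w, adj u w -> cadj (apex b) u && cadj (apex b) w}.
  by rewrite BE /apex => /or3P[]/eqP->; rewrite ?eqxx ?m21 ?m31 ?m32.
have two_nbrs t t' u : t \in T -> t' \in T -> t != t' -> u \in outer ->
    adj t u -> adj t' u -> adj (q a) u.
  move=> tT t'T tt' uH tu t'u; have qu := outer_neq a uH.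
  have tt : adj t t'.
    move: tT t'T tt'; rewrite !TE => /or3P[]/eqP-> /or3P[]/eqP->;
    by rewrite ?eqxx // adj_sym.
  have [_ at_ _] := Tprop t tT; have [_ at' _] := Tprop t' t'T.
  by move: (dG t t' u (q a)); adj_split.
have T_label t x : t \in T -> x \in outer -> labelled x -> label x != a -> adj t x ->
    t = apex (label x).
  move=> tT xH lx xa tx; have [tH at_ ta] := Tprop t tT.
  have lB := cover _ xa.
  have tS : t \in sector a (label x) by apply: sector_l.
  have xS : x \in sector a (label x) by apply: sector_r.
  have /andP[_ zx] := center _ lB t x tS xS tx.
  apply/eqP; apply: contraT => tz; have zT := apexT (label x).
  case/predU1P: zx => [zx|zx].
    by have [_ _ za] := Tprop _ zT; rewrite zx in za; rewrite za eqxx in xa.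
  have ax := two_nbrs t _ x tT zT tz xH tx zx.
  by rewrite (labelP xH ax) eqxx in xa.
have same_label x y : x \in outer -> y \in outer -> labelled x -> labelled y ->
    label x != a -> label y = label x -> ~~ adj x y.
  move=> xH yH lx ly xa lyx; apply/negP=> xy; have lB := cover _ xa.
  have xS : x \in sector a (label x) by apply: sector_r.
  have qy : adj (q (label x)) y by rewrite -lyx.
  have yS : y \in sector a (label x) by apply: sector_r.
  have := center _ lB x y xS yS xy; have zT := apexT (label x).
  have [zH az za] := Tprop _ zT; move: (apex _) zT zH az za => z zT zH az za.
  have zx : z != x by apply: contraNneq xa => <-; rewrite za.
  have zy : z != y by apply: contraNneq xa => zy; rewrite -lyx -zy za.
  rewrite /cadj (negbTE zx) (negbTE zy) /= => /andP[azx azy].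
  have qz : adj (q (label x)) z by apply: triangle_same_label zH _ lx qy; rewrite /triangle xy adj_sym azy adj_sym azx.
  by rewrite (labelP zH qz) za eqxx in xa.
(* An edge at [x] makes some apex adjacent to [x]. For an unlabelled [x], this new edge lies in
   another sector too, and a second apex next to [x] forces the label [a]. For the label [a], [x]
   sees the whole triangle, which gives a K5. *)
have neutral x y : x \in outer -> y \in outer -> x \notin T ->
    ~~ labelled x || (label x == a) -> ~~ adj x y.
  move=> xH yH xT xl; apply/negP=> xy.
  have [b bB /andP[xS yS]] : exists2 b, b \in B & (x \in sector a b) && (y \in sector a b).
    have xSb b : x \in sector a b.
      case/orP: xl => [lx|/eqP lx]; first exact: sector_unlabelled.
      by rewrite inE xH lx !inE eqxx implybT.
    have [ly|ly] := eqVneq (label y) a.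
      exists b1; first by rewrite BE eqxx.
      by rewrite xSb inE yH ly !inE eqxx implybT.
    exists (label y); first exact: cover.
    by rewrite xSb inE yH !inE eqxx orbT implybT.
  have xnT t : t \in T -> (t == x) = false.
    by move=> tT; apply: contraNF xT => /eqP<-.
  have hub b' : b' \in B -> x \in sector a b' -> (exists2 w, w \in sector a b' & adj x w) ->
      adj (apex b') x.
    move=> b'B xS' [w wS xw]; have /andP[+ _] := center b' b'B x w xS' wS xw.
    by rewrite /cadj xnT.
  have zx : adj (apex b) x by apply: hub => //; exists y.
  have [lx|lx] := boolP (labelled x); last first.
    have b'B : next b \in B by rewrite BE /next; do ![case: ifP => _]; rewrite eqxx ?orbT.
    have [zH az _] := Tprop _ (apexT b).
    have z'x : adj (apex (next b)) x.
      apply: hub => //; first exact: sector_unlabelled.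
      by exists (apex b); [apply: sector_l | rewrite adj_sym].
    have zz' : apex b != apex (next b).
      move: bB; rewrite BE /apex /next => /or3P[]/eqP->;
      rewrite ?eqxx ?m21 ?m31 ?m32 ?eqxx ?m21 ?m31 ?m32.
      - by rewrite eq_sym n21.
      - by rewrite eq_sym n32.
      by rewrite n31.
    have ax := two_nbrs _ _ x (apexT b) (apexT _) zz' xH zx z'x.
    by have := labelledPn a lx; rewrite ax.
  have ax : adj (q a) x by move: xl; rewrite lx /= => /eqP<-.
  have all_T : [&& cadj t1 x, cadj t2 x & cadj t3 x].
    have := apexT b; rewrite TE => /or3P[]/eqP zE; rewrite zE in zx.
    - have /andP[-> ->] := mono_nbr M1 xH zx (introT orP (or_introl ax)).
      by rewrite /cadj zx orbT.
    - have /andP[-> ->] := mono_nbr M2 xH zx (introT orP (or_introl ax)).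
      by rewrite /cadj zx orbT.
    have /andP[-> ->] := mono_nbr M3 xH zx (introT orP (or_introl ax)).
    by rewrite /cadj zx orbT.
  case/and3P: all_T; rewrite !(cadj_sym _ x) => c1 c2 c3.
  by move: xT; rewrite TE (mono_dominated M1 xH c1 c2 c3).
have cN x : x \notin T -> c x = next (label x).
  by rewrite TE !negb_or /c => /and3P[/negbTE-> /negbTE-> /negbTE->].
exists c; split=> [x xH i /(labelP xH)->|x y xH yH xy].
  have [xT|/cN->//] := boolP (x \in T).
  by have [_ _ ->] := Tprop x xT; apply: Ba; case: (cT x xT).
have kind u w : u \in outer -> w \in outer -> adj u w -> u \notin T ->
    labelled u /\ label u != a.
  move=> uH wH uw uT; have := neutral u w uH wH uT.
  by rewrite uw; case: (labelled u); case: eqP => //= _ /(_ isT).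
have [xT|xT] := boolP (x \in T); have [yT|yT] := boolP (y \in T).
- apply: contraTneq xy => cxy; have [_ <-] := cT x xT; have [_ <-] := cT y yT.
  by rewrite cxy adj_irrefl.
- have [ly lya] := kind y x yH xH (etrans (adj_sym _ _) xy) yT.
  rewrite (cN y yT); have := T_label x y xT yH ly lya xy.
  have [cB cx] := cT x xT => xE; have E : c x = label y.
    have lB := cover _ lya; move: lB xE; rewrite BE /apex /c => /or3P[]/eqP-> ->;
    by rewrite ?eqxx ?m21 ?m31 ?m32 ?eqxx ?n21 ?n31 ?n32 ?eqxx.
  by rewrite E eq_sym.
- have [lx lxa] := kind x y xH yH xy xT.
  have yx : adj y x by rewrite adj_sym.
  rewrite (cN x xT); have := T_label y x yT xH lx lxa yx.
  have [cB cy] := cT y yT => yE; have E : c y = label x.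
    have lB := cover _ lxa; move: lB yE; rewrite BE /apex /c => /or3P[]/eqP-> ->;
    by rewrite ?eqxx ?m21 ?m31 ?m32 ?eqxx ?n21 ?n31 ?n32 ?eqxx.
  by rewrite E.
have [lx lxa] := kind x y xH yH xy xT.
have [ly lya] := kind y x yH xH (etrans (adj_sym _ _) xy) yT.
rewrite !cN //; apply: contraTneq xy => nxy; apply: same_label => //.
by apply/esym/next_inj => //; apply: cover.
Qed.

End MonochromaticTriangle.

(** * No monochromatic triangle *)

Section NoMonochromaticTriangle.

Hypothesis no_mono : forall i t1 t2 t3, ~~ mono i t1 t2 t3.

Lemma no_same_label i x y z :
  [&& x \in outer, y \in outer & z \in outer] -> triangle x y z ->
  adj (q i) x -> adj (q i) y -> False.
Proof.
move=> H xyz ix iy; have iz := triangle_same_label (proj2 (andP (proj2 (andP H)))) xyz ix iy.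
by have /negP[] := no_mono i x y z; rewrite /mono xyz ix iy iz H.
Qed.

(** The bipartite sector uses the other two colors [l], [m]. Outside it only the labels [l], [m]
    occur, so a triangle would repeat a label; that part is bipartite too and uses [i], [j]. *)
Lemma triangle_free_sector i j : i != j -> triangle_free (sector i j) ->
  list_colorable outer.
Proof.
move=> ij tS; have [c1 c1P] := P4_triangle_free_bipartite (sector_P4_free ij) tS.
have [|l [m [lm]]] := @exists_color2 [:: i; j]; first exact: k_ge4.
rewrite !inE !negb_or => /andP[li lj] /andP[mi mj].
have U : uniq [:: i; j; l; m].
  by rewrite /= !inE !negb_or ij lm !(eq_sym i) !(eq_sym j) li lj mi mj.
pose Y := outer :\: sector i j.
have YP x : x \in Y -> [/\ x \in outer, labelled x, label x != i, label x != j
    & label x \in [:: l; m]].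
  rewrite inE => /andP[xS xH]; move: xS; rewrite inE xH negb_imply !inE negb_or.
  case/and3P=> lx xi xj; split=> //; have := label_cover (label x) U.
  by rewrite !inE (negbTE xi) (negbTE xj).
have YS : Y \subset sector l m.
  by apply/subsetP=> x /YP[xH _ _ _ lx]; rewrite inE xH lx implybT.
have tY : triangle_free Y.
  move=> x y z /YP[xH lx _ _ xlm] /YP[yH ly _ _ ylm] /YP[zH lz _ _ zlm].
  apply/negP=> xyz.
  have H3 : [&& x \in outer, y \in outer & z \in outer] by rewrite xH yH zH.
  have H3' : [&& y \in outer, z \in outer & x \in outer] by rewrite xH yH zH.
  have H3'' : [&& z \in outer, x \in outer & y \in outer] by rewrite xH yH zH.
  have yzx : triangle y z x by rewrite -triangle_rot.
  have zxy : triangle z x y by rewrite triangle_rot.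
  have [xy|xy] := eqVneq (label x) (label y).
    by apply: no_same_label H3 xyz lx _; rewrite xy.
  have [yz|yz] := eqVneq (label y) (label z).
    by apply: no_same_label H3' yzx ly _; rewrite yz.
  apply: no_same_label H3'' zxy lz _; suff -> : label z = label x by [].
  move: xlm ylm zlm xy yz; rewrite !inE.
  by case/orP=> /eqP-> /orP[]/eqP-> /orP[]/eqP->; rewrite ?eqxx.
have [c2 c2P] := P4_triangle_free_bipartite (P4_free_sub YS (sector_P4_free lm)) tY.
exists (fun x => if x \in sector i j then if c1 x then l else m
                 else if c2 x then i else j); split.
  move=> x xH n nx; have nE := labelP xH nx; case: ifP => xS.
    apply: contraL nx => /eqP<-; case: (c1 x).
      exact: sector_label xS li lj.
    exact: sector_label xS mi mj.
  have [|_ _ xi xj _] := YP x; first by rewrite inE xS xH.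
  by rewrite nE; case: (c2 x); rewrite eq_sym.
move=> x y xH yH xy.
have inY z : z \in outer -> z \notin sector i j -> z \in Y.
  by move=> zH zS; rewrite inE zS zH.
have [xS|xS] := boolP (x \in sector i j); have [yS|yS] := boolP (y \in sector i j).
- by have := c1P x y xS yS xy; case: (c1 x) (c1 y) => [] [] // _; rewrite eq_sym.
- by case: (c1 x) (c2 y) => [] []; rewrite // eq_sym.
- by case: (c2 x) (c1 y) => [] []; rewrite // eq_sym.
have := c2P x y (inY x xH xS) (inY y yH yS) xy.
by case: (c2 x) (c2 y) => [] [] // _; rewrite eq_sym.
Qed.

Hypothesis sector_tri : forall i j, i != j ->
  exists x y z, [/\ x \in sector i j, y \in sector i j, z \in sector i j & triangle x y z].

Lemma unlabelled_nbr r u : ~~ labelled r -> adj r u -> u \in outer.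
Proof.
move=> lr ru; rewrite inE; apply/negP=> /codomP[i ui].
by have := labelledPn i lr; rewrite -ui adj_sym ru.
Qed.

Lemma sector_same_label i j x y : x \in sector i j -> y \in outer ->
  labelled x -> label x = label y -> y \in sector i j.
Proof. by rewrite !inE => /andP[_ /implyP xl] -> /xl + <- => ->; rewrite implybT. Qed.

(** By [attach_unique], private neighbours [c] of [r] and [d] of [s] share no sector with [w]. So
    [c] and [d] have distinct labels, and [c r s d] closes to a 4-cycle; the center of their sector
    sees all of it, which gives a diamond. *)
Lemma no_unlabelled_edge_triangle w r s : w \in outer -> r \in outer ->
  s \in outer -> ~~ labelled r -> ~~ labelled s -> triangle w r s -> False.
Proof.
move=> wH rH sH lr ls /[dup] wrs /and3P[wr rs ws].
have sr : adj s r by rewrite adj_sym.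
have [c rc] := exists_private_nbr rH rs; rewrite negb_or => /andP[sc nsc].
have [d sd] := exists_private_nbr sH sr; rewrite negb_or => /andP[rd nrd].
have cH := unlabelled_nbr lr rc; have dH := unlabelled_nbr ls sd.
have rsw : triangle r s w by rewrite -triangle_rot.
have att i j : i != j -> w \in sector i j -> c \in sector i j -> d \in sector i j -> False.
  move=> ij wS cS dS.
  apply: (@attach_unique G dG (sector i j) r s w c d) => //.
  - exact: sector_P4_free.
  - by rewrite (sector_unlabelled i j rH lr) (sector_unlabelled i j sH ls) wS cS dS.
  - by rewrite eq_sym.
  - by rewrite eq_sym.
  - by rewrite adj_sym.
  - by rewrite adj_sym.
  - by rewrite adj_sym.
  by rewrite adj_sym.
have pair u v : u \in outer -> v \in outer ->
    exists2 j, label u != j & (u \in sector (label u) j) && (v \in sector (label u) j).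
  by move=> uH vH; apply: common_sector; rewrite ?eqxx ?orbT.
have [lw|lw] := boolP (labelled w); last first.
  have [j ij /andP[cS dS]] := pair c d cH dH.
  by apply: att ij _ cS dS; apply: sector_unlabelled.
have [lc|lc] := boolP (labelled c); last first.
  have [j ij /andP[wS dS]] := pair w d wH dH.
  by apply: att ij wS _ dS; apply: sector_unlabelled.
have [ld|ld] := boolP (labelled d); last first.
  have [j ij /andP[wS cS]] := pair w c wH cH.
  by apply: att ij wS cS _; apply: sector_unlabelled.
have [cd|cd] := eqVneq (label c) (label d).
  have [j ij /andP[wS cS]] := pair w c wH cH.
  exact: (att _ _ ij wS cS (sector_same_label cS dH lc cd)).
have cS : c \in sector (label c) (label d) by apply: sector_l.
have dS : d \in sector (label c) (label d) by apply: sector_r.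
have rS := sector_unlabelled (label c) (label d) rH lr.
have sS := sector_unlabelled (label c) (label d) sH ls.
have acd : adj c d.
  by move: (sector_P4_free cd cS rS sS dS); adj_split.
have [x [y [z [xS yS zS xyz]]]] := sector_tri cd.
have T3 : [&& x \in sector (label c) (label d), y \in sector (label c) (label d)
    & z \in sector (label c) (label d)] by rewrite xS yS zS.
have [o [oS oP] _] := sector_windmill cd cH dH lc ld acd T3 xyz.
have /andP[oc od] := oP c d cS dS acd; have /andP[or_ os] := oP r s rS sS rs.
have n1 : o != c by apply: contraTneq os => ->; rewrite /cadj eq_sym (negbTE sc) adj_sym.
have n2 : o != r by apply: contraTneq od => ->; rewrite /cadj (negbTE rd).
have n3 : o != s by apply: contraTneq oc => ->; rewrite /cadj (negbTE sc).
move: oc os or_ (dG o r c s); adj_split.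
Qed.

Lemma sector_kind i j t : t \in sector i j ->
  [\/ adj (q i) t, adj (q j) t | ~~ labelled t].
Proof.
rewrite inE => /andP[_]; have [lt /=|lt _] := boolP (labelled t); last by constructor 3.
by rewrite !inE => /pred2P[] E; [constructor 1 | constructor 2]; rewrite -E.
Qed.

Definition mixed_triangle i j x y r : bool :=
  [&& [&& x \in outer, y \in outer & r \in outer], adj (q i) x, adj (q j) y,
      ~~ labelled r & triangle x y r].

(** A triangle in the sector repeats no label and has at most one unlabelled vertex. *)
Lemma mixed_triangle_exists i j : i != j -> exists x y r, mixed_triangle i j x y r.
Proof.
move=> ij; have [x [y [z [xS yS zS xyz]]]] := sector_tri ij.
have xH := sector_outer xS; have yH := sector_outer yS; have zH := sector_outer zS.
have yzx : triangle y z x by rewrite -triangle_rot.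
have zxy : triangle z x y by rewrite triangle_rot.
have xzy : triangle x z y by rewrite triangle_swap.
have zyx : triangle z y x by rewrite triangle_swap.
have yxz : triangle y x z by rewrite triangle_swap.
have no l u v w : u \in outer -> v \in outer -> w \in outer -> triangle u v w ->
    adj (q l) u -> adj (q l) v -> False.
  by move=> uH vH wH; apply: no_same_label; rewrite uH vH wH.
have noR := no_unlabelled_edge_triangle.
have yes u v w : u \in outer -> v \in outer -> w \in outer -> triangle u v w ->
    adj (q i) u -> adj (q j) v -> ~~ labelled w -> exists x y r, mixed_triangle i j x y r.
  by move=> uH vH wH uvw iu jv lw; exists u, v, w; rewrite /mixed_triangle uH vH wH iu jv lw.
case: (sector_kind xS) => kx; case: (sector_kind yS) => ky; case: (sector_kind zS) => kz;
first [ by case: (no _ _ _ _ xH yH zH xyz kx ky)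
      | by case: (no _ _ _ _ xH zH yH xzy kx kz)
      | by case: (no _ _ _ _ yH zH xH yzx ky kz)
      | by case: (noR _ _ _ xH yH zH ky kz xyz)
      | by case: (noR _ _ _ yH zH xH kz kx yzx)
      | by case: (noR _ _ _ zH xH yH kx ky zxy)
      | exact: (yes _ _ _ xH yH zH xyz kx ky kz)
      | exact: (yes _ _ _ xH zH yH xzy kx kz ky)
      | exact: (yes _ _ _ yH xH zH yxz ky kx kz)
      | exact: (yes _ _ _ yH zH xH yzx ky kz kx)
      | exact: (yes _ _ _ zH xH yH zxy kz kx ky)
      | exact: (yes _ _ _ zH yH xH zyx kz ky kx)].
Qed.

Lemma sector_center_exists i j : i != j -> exists z, sector_center i j z.
Proof.
move=> ij; have [x [y [r /and5P[/and3P[xH yH rH] ix jy lr xyr]]]] := mixed_triangle_exists ij.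
have /and3P[xy _ _] := xyr.
have [||z zP _] := sector_windmill (t1 := x) (t2 := y) (t3 := r) ij xH yH ix jy xy.
- by rewrite sector_l // sector_r // sector_unlabelled.
- exact: xyr.
by exists z.
Qed.

Section OffCenter.

Variables (i j : 'I_k) (z r : G).
Hypotheses (zP : sector_center i j z) (rH : r \in outer) (lr : ~~ labelled r).
Hypothesis zr : z != r.

Let near_center x : x \in sector i j -> adj r x -> adj z r /\ cadj z x.
Proof.
move=> xS rx; have [zS /(_ r x (sector_unlabelled i j rH lr) xS rx)/andP[zr' zx]] := zP.
by move: zr'; rewrite /cadj (negbTE zr).
Qed.

(** Both lie in the closed neighbourhood of [z], so by diamond-freeness on [zr] they would be
    adjacent, and [r] would complete a triangle with a repeated label. *)
Lemma off_center_unique x x' : x \in outer -> x' \in outer ->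
  adj (q i) x -> adj (q i) x' -> adj r x -> adj r x' -> x = x'.
Proof.
move=> xH x'H ix ix' rx rx'; apply/eqP; apply: contraT => xx'.
have [zr' zx] := near_center (sector_l j xH ix) rx.
have [_ zx'] := near_center (sector_l j x'H ix') rx'.
have axx' : adj x x'.
  case/predU1P: zx => [zx|zx]; case/predU1P: zx' => [zx'|zx'].
  - by rewrite -zx -zx' eqxx in xx'.
  - by rewrite -zx.
  - by rewrite -zx' adj_sym.
  by move: (dG z r x x'); adj_split.
case: (@no_same_label i x x' r) => //; first by rewrite xH x'H rH.
by rewrite /triangle axx' !(adj_sym _ r) rx rx'.
Qed.

Lemma off_center_adj x y : x \in outer -> y \in outer -> i != j ->
  adj (q i) x -> adj (q j) y -> adj r x -> adj r y -> adj x y.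
Proof.
move=> xH yH ij ix jy rx ry.
have [zr' zx] := near_center (sector_l j xH ix) rx.
have [_ zy] := near_center (sector_r i yH jy) ry.
have xy : x != y by apply: contraNneq ij => E; apply/eqP/(label_unique xH ix); rewrite E.
case/predU1P: zx => [zx|zx]; case/predU1P: zy => [zy|zy].
- by rewrite -zx -zy eqxx in xy.
- by rewrite -zx.
- by rewrite -zy adj_sym.
by move: (dG z r x y); adj_split.
Qed.

End OffCenter.

(** If all centers were labelled, the neighbours of an unlabelled [r] would be labelled by
    [no_unlabelled_edge_triangle], and pairwise adjacent by [off_center_unique] and
    [off_center_adj]. With [r] they would form too large a clique. *)
Lemma unlabelled_center_exists : exists i j r,
  [/\ i != j, r \in outer, ~~ labelled r & sector_center i j r].
Proof.
case: (pickP [pred p : 'I_k * 'I_k * G | [&& p.1.1 != p.1.2, p.2 \in outer, ~~ labelled p.2,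
    p.2 \in sector p.1.1 p.1.2 & [forall u in sector p.1.1 p.1.2,
      forall v in sector p.1.1 p.1.2, adj u v ==> cadj p.2 u && cadj p.2 v]]]).
  case=> [[i j] r] /= /and5P[ij rH lr rS /forall_inP P]; exists i, j, r; split=> //.
  by split=> // u v uS vS uv; have /forall_inP/(_ v vS)/implyP := P u uS; apply.
move=> p0; have lab i j z : i != j -> sector_center i j z -> labelled z.
  move=> ij [zS zP]; apply: contraT => lz; have := p0 (i, j, z).
  rewrite /= ij (sector_outer zS) lz zS /= => /negbT/negP[].
  by apply/forall_inP=> u uS; apply/forall_inP=> v vS; apply/implyP; apply: zP.
have [|i0] := @exists_color set0; first by rewrite cards0 (leq_trans _ k_ge4).
have other (i : 'I_k) : exists j : 'I_k, i != j.
  have [|j] := @exists_color [set i]; first by rewrite cards1 (leq_trans _ k_ge4).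
  by rewrite inE eq_sym; exists j.
have [j0 ij0] := other i0.
have [_ [_ [r /and5P[/and3P[_ _ rH] _ _ lr _]]]] := mixed_triangle_exists ij0.
have off i j z : i != j -> sector_center i j z -> z != r.
  by move=> ij /(lab i j z ij); apply: contraTneq => ->.
have nbr_lab s : adj r s -> labelled s.
  move=> rs; apply: contraT => ls; have [z zP] := sector_center_exists ij0.
  have sH := unlabelled_nbr lr rs; have lz := lab _ _ _ ij0 zP; have zr := off _ _ _ ij0 zP.
  have [zS /(_ r s (sector_unlabelled _ _ rH lr) (sector_unlabelled _ _ sH ls) rs)] := zP.
  have zs : z != s by apply: contraTneq lz => ->.
  rewrite /cadj (negbTE zr) (negbTE zs) /= => /andP[zr' zs'].
  case: (no_unlabelled_edge_triangle (sector_outer zS) rH sH lr ls).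
  by rewrite /triangle zr' rs zs'.
have : #|r |: nbhd r| <= k.
  apply: clique_le; apply/cliqueP=> u v; rewrite !inE.
  case/predU1P=> [->|ru] /predU1P[->|rv] uv; rewrite ?eqxx // in uv *.
    by rewrite adj_sym.
  have uH := unlabelled_nbr lr ru; have vH := unlabelled_nbr lr rv.
  have lu := nbr_lab u ru; have lv := nbr_lab v rv.
  have [E|luv] := eqVneq (label u) (label v).
    have [j uj] := other (label u); have [z zP] := sector_center_exists uj.
    have vq : adj (q (label u)) v by rewrite E.
    by rewrite (off_center_unique zP rH lr (off _ _ _ uj zP) uH vH lu vq ru rv) eqxx in uv.
  have [z zP] := sector_center_exists luv.
  exact: (off_center_adj zP rH lr (off _ _ _ luv zP) uH vH luv lu lv ru rv).
by rewrite cardsU1 inE adj_irrefl add1n ltnNge (deg_ge rH).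
Qed.

(** Once [r] is the center of every sector, its closed neighbourhood contains all edges of
    [outer]. *)
Lemma mixed_list_colorable : list_colorable outer.
Proof.
have [a [b [r [ab rH lr rP]]]] := unlabelled_center_exists.
have far_r r' x : r' \in outer -> ~~ labelled r' -> r' != r -> x \in outer ->
    adj (q a) x || adj (q b) x -> ~~ adj r' x.
  move=> r'H lr' r'r xH qx; apply/negP=> r'x; have [_ rP'] := rP.
  have xS : x \in sector a b by case/orP: qx; [apply: sector_l | apply: sector_r].
  have /andP[] := rP' r' x (sector_unlabelled _ _ r'H lr') xS r'x.
  have rx : r != x.
    apply: contraTneq qx => <-; rewrite negb_or.
    by rewrite (labelledPn a lr) (labelledPn b lr).
  rewrite /cadj eq_sym (negbTE r'r) (negbTE rx) /= => rr' rx'.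
  case: (no_unlabelled_edge_triangle xH rH r'H lr lr').
  by rewrite /triangle adj_sym rx' rr' adj_sym r'x.
(* If the triangle sits at another [r'], then [i] and [j] differ from [a] by [far_r], and the mixed
   triangles for [a], [i] and for [a], [j] give [r] neighbours of labels [i] and [j]. These are
   adjacent unless [r] is the center, in which case [x], [r], [r'] form a forbidden triangle. *)
have at_r i j : i != j -> exists x y, mixed_triangle i j x y r.
  move=> ij; have [x [y [r' M]]] := mixed_triangle_exists ij.
  have [r'E|r'r] := eqVneq r' r; first by exists x, y; rewrite -r'E.
  have /and5P[/and3P[xH yH r'H] ix jy lr' xyr'] := M; have /and3P[xy yr' xr'] := xyr'.
  have far_ := far_r r' _ r'H lr' r'r.
  have ra l : a != l -> exists2 u, (u \in outer) && adj (q l) u & adj r u.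
    move=> al; have [x1 [y1 [r1 /and5P[/and3P[x1H y1H r1H] ax1 ly1 lr1 T1]]]] :=
      mixed_triangle_exists al.
    have /and3P[xy1 yr1 xr1] := T1.
    have r1E : r1 = r.
      apply/eqP; apply: contraT => n; have := far_r r1 x1 r1H lr1 n x1H.
      by rewrite ax1 (adj_sym r1) xr1 => /(_ isT).
    by exists y1; rewrite ?y1H // -r1E adj_sym.
  have ai : a != i.
    by apply: contraTneq ix => <-; apply: contraTN xr' => ax; rewrite adj_sym far_ // ax.
  have aj : a != j.
    by apply: contraTneq jy => <-; apply: contraTN yr' => ay; rewrite adj_sym far_ // ay.
  have [u /andP[uH iu] ru] := ra i ai; have [v /andP[vH jv] rv] := ra j aj.
  have [z zP] := sector_center_exists ij; have [zr|zr] := eqVneq z r; last first.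
    have uv := off_center_adj zP rH lr zr uH vH ij iu jv ru rv.
    exists u, v; rewrite /mixed_triangle uH vH rH iu jv lr /triangle uv.
    by rewrite !(adj_sym _ r) ru rv.
  have [_ zP'] := zP; have xS := sector_l j xH ix.
  have /andP[] := zP' x r' xS (sector_unlabelled _ _ r'H lr') xr'.
  have rx : r != x by apply: contraTneq ix => <-; apply: labelledPn.
  rewrite zr /cadj (eq_sym r r') (negbTE r'r) (negbTE rx) /= => rx' rr'.
  case: (no_unlabelled_edge_triangle xH rH r'H lr lr').
  by rewrite /triangle adj_sym rx' rr' xr'.
(* Off the center, the mixed triangles at [r] for [i] and each other label share the vertex [x] of
   label [i]. Their third vertices are pairwise adjacent by diamond-freeness, which gives a K5. *)
have center i j : i != j -> sector_center i j r.
  move=> ij; have [z zP] := sector_center_exists ij.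
  have [<- //|zr] := eqVneq z r.
  have [|l [m [lm]]] := @exists_color2 [:: i; j]; first exact: k_ge4.
  rewrite !inE !negb_or => /andP[li lj] /andP[mi mj].
  have il : i != l by rewrite eq_sym. have im : i != m by rewrite eq_sym.
  have [x [y /and5P[/and3P[xH yH _] ix jy _ /and3P[xy yr xr]]]] := at_r i j ij.
  have [x1 [u /and5P[/and3P[x1H uH _] ix1 lu _ /and3P[xu ur x1r]]]] := at_r i l il.
  have [x2 [v /and5P[/and3P[x2H vH _] ix2 mv _ /and3P[xv vr x2r]]]] := at_r i m im.
  have uniq_x x' : x' \in outer -> adj (q i) x' -> adj x' r -> x' = x.
    move=> x'H ix' x'r; apply: (off_center_unique zP rH lr zr x'H xH ix' ix);
    by rewrite adj_sym.
  rewrite (uniq_x x1) // in xu; rewrite (uniq_x x2) // in xv.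
  have diff p p' s t : p != p' -> s \in outer -> adj (q p) s -> adj (q p') t -> s != t.
    move=> pp' sH ps p't; apply: contraNneq pp' => E.
    by apply/eqP/(label_unique sH ps); rewrite E.
  have jl : j != l by rewrite eq_sym. have jm : j != m by rewrite eq_sym.
  have yu := diff _ _ _ _ jl yH jy lu; have yv := diff _ _ _ _ jm yH jy mv.
  have uv := diff _ _ _ _ lm uH lu mv.
  have := no_K5 r x y u v; rewrite /=.
  by move: (dG r x y u) (dG r x y v) (dG r x u v); adj_split.
pose D := [set u in outer | cadj r u].
have edge u v : u \in outer -> v \in outer -> adj u v -> cadj r u && cadj r v.
  move=> uH vH uv; have [|j ij /andP[uS vS]] := @common_sector (label u) u v uH vH.
    by rewrite eqxx orbT.
  by have [_ P] := center _ _ ij; apply: P.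
apply: (@list_colorable_union _ D).
- by apply/subsetP=> u; rewrite inE => /andP[].
- move=> u v; rewrite inE => /andP[uH ru]; rewrite in_setD => /andP[vD vH].
  apply: contra vD => uv; rewrite inE vH.
  by case/andP: (edge u v uH vH uv).
- apply: (@dominated_list_colorable D r).
  + by apply/subsetP=> u; rewrite inE => /andP[].
  + by rewrite inE rH /cadj eqxx.
  by move=> u; rewrite inE => /andP[].
apply: P4_free_list_colorable; first exact: subsetDl.
move=> u v w x; rewrite !in_setD => /andP[uD uH] /andP[_ vH] _ _.
apply/negP=> /andP[uv _]; move: uD; rewrite inE uH.
by case/andP: (edge u v uH vH uv) => ->.
Qed.

End NoMonochromaticTriangle.

Lemma four_colors_list_colorable : list_colorable outer.
Proof.
case: (pickP [pred p : 'I_k * (G * G * G) | mono p.1 p.2.1.1 p.2.1.2 p.2.2]).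
  by case=> i [[x y] z] /= /mono_list_colorable.
move=> m0; have no_mono i x y z : ~~ mono i x y z by have := m0 (i, (x, y, z)) => /= ->.
case: (pickP [pred p : 'I_k * 'I_k | (p.1 != p.2) &&
    [forall x in sector p.1 p.2, forall y in sector p.1 p.2,
     forall z in sector p.1 p.2, ~~ triangle x y z]]).
  case=> i j /= /andP[ij /forall_inP tS]; apply: (triangle_free_sector no_mono ij).
  by move=> x y z xS yS zS; have /forall_inP/(_ y yS)/forall_inP := tS x xS; apply.
move=> t0; apply: (mixed_list_colorable no_mono) => i j ij.
have /negbT := t0 (i, j); rewrite /= ij negb_forall_in => /exists_inP[x xS].
rewrite negb_forall_in => /exists_inP[y yS].
rewrite negb_forall_in => /exists_inP[z zS]; rewrite negbK.
by exists x, y, z.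
Qed.

End FourColors.

Lemma large_clique_colorable_deg : colorable G k.
Proof.
apply: list_colorable_colorable; case: (leqP k 4) => hk.
  exact: four_colors_list_colorable.
exact: five_colors_list_colorable.
Qed.

End LargeClique.

(** Only vertices outside the clique are deleted, so [q] survives the induction. *)
Lemma large_clique_colorable (k : nat) (G : sgraph) (q : 'I_k -> G) : 4 <= k ->
  P2P4_free G -> diamond_free G -> (forall i j, i != j -> adj (q i) (q j)) ->
  (forall S : {set G}, clique S -> #|S| <= k) -> colorable G k.
Proof.
move=> k4; have [n] := ubnP #|G|; elim: n G q => // n IHn G q.
rewrite ltnS => Gn pG dG q_adj Gk.
have [/forall_inP deg|] := boolP [forall x in outer q, k <= #|nbhd x|].
  exact: (@large_clique_colorable_deg G k q).
rewrite negb_forall_in => /exists_inP[v vH]; rewrite -ltnNge => vk.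
have qv i : q i \in [set~ v] by rewrite !inE eq_sym outer_neq.
apply: del_vertex_colorable vk.
apply: (IHn (induced [set~ v]) (fun i => Sub (q i) (qv i))).
- exact: leq_trans (del_vertex_card v) Gn.
- exact: induced_P2P4_free.
- exact: induced_diamond_free.
- by move=> i j /q_adj.
move=> S /cliqueP Scl; rewrite -(card_imset _ val_inj); apply: Gk.
apply/cliqueP=> _ _ /imsetP[x xS ->] /imsetP[y yS ->] xy.
by apply: (Scl x y xS yS); apply: contraNneq xy => ->.
Qed.

(** * The bounds and their tightness *)

Lemma clique_seq_le (G : sgraph) (p : seq G) :
  pairwise (@adj G) p -> size p <= clique_number G.
Proof.
by apply: pairwise_adj_le => S; apply: clique_number_ge.
Qed.

Theorem theorem1p3 :
  (forall G : sgraph, free [:: P2_union_P4; diamond] G ->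
    [/\ clique_number G = 2 -> chromatic_number G <= 4,
        clique_number G = 3 -> chromatic_number G <= 6
      & 4 <= clique_number G -> chromatic_number G = clique_number G]) /\
  (exists G : sgraph, [/\ free [:: P2_union_P4; diamond] G,
    clique_number G = 2 & chromatic_number G = 4]) /\
  (exists G : sgraph, [/\ free [:: P2_union_P4; diamond] G,
    clique_number G = 3 & chromatic_number G = 6]).
Proof.
split; last split.
- move=> G /freeP[pG dG]; split=> [w2|w3|w4].
  + apply/chromatic_number_le/triangle_free_colorable => // x y z _ _ _.
    apply/negP=> /and3P[xy yz xz].
    have := @clique_seq_le G [:: x; y; z].
    by rewrite w2 /= xy yz xz => /(_ isT).
  + apply/chromatic_number_le/K4_free_colorable => // x y z w.
    apply/negP=> /and4P[/and3P[xy yz xz] wx wy wz].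
    have := @clique_seq_le G [:: w; x; y; z].
    by rewrite w3 /= xy yz xz wx wy wz => /(_ isT).
  apply/eqP; rewrite eqn_leq clique_number_le_chromatic andbT.
  apply: chromatic_number_le; have [S /cliqueP Scl SE] := max_clique_ex G.
  pose q (i : 'I_(clique_number G)) : G := enum_val (cast_ord (esym SE) i).
  apply: (large_clique_colorable (q := q)) => // [i j ij|T].
    by apply: Scl; rewrite ?enum_valP // (inj_eq enum_val_inj) (inj_eq (@cast_ord_inj _ _ _)).
  exact: clique_number_ge.
- exists groetzsch; split.
  + exact: groetzsch_free.
  + exact: groetzsch_clique_number.
  exact: groetzsch_chromatic_number.
exists lines_graph; split.
- exact: lines_free.
- exact: lines_clique_number.
exact: lines_chromatic_number.
Qed.
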